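(* Let $p$ be a prime and $n$ a natural number with $p>(n+1)^{n+1}+1$. Then the group of flows construction gives a one-to-one correspondence between powerful left nilpotent pre-Lie rings of cardinality $p^{n}$ and left braces of cardinality $p^{n}$ whose adjoint group is powerful, where the brace corresponding to a pre-Lie ring $(A,+,\cdot)$ is $(A,+,\circ)$ with the same additive group. That is: the group-of-flows brace of every powerful left nilpotent pre-Lie ring of cardinality $p^{n}$ has powerful adjoint group; every brace of cardinality $p^{n}$ with powerful adjoint group arises in this way from a powerful left nilpotent (indeed strongly nilpotent) pre-Lie ring with the same additive group; and this pairing is bijective.
   Context: A (left) brace is a set $A$ with operations $+,\circ$ such that $(A,+)$ is an abelian group, $(A,\circ)$ is a group (the adjoint group), and $a\circ(b+c)+a=a\circ b+a\circ c$. A pre-Lie ring is an abelian group with a bi-additive $\cdot$ satisfying $(x\cdot y)\cdot z-x\cdot(y\cdot z)=(y\cdot x)\cdot z-y\cdot(x\cdot z)$; it is left nilpotent if for some $m$ all $a_1\cdot(a_2\cdot(\cdots\cdot a_m))$ vanish, and powerful if $a\cdot b-b\cdot a\in pA$ for all $a,b$ (for $p>2$). Group of flows: with $L_a(b)=a\cdot b$, $e^{L_a}(b)=\sum_{k\ge0}\frac1{k!}L_a^{k}(b)$, $W(a)=\sum_{k\ge1}\frac1{k!}L_a^{k-1}(a)$, $\Omega=W^{-1}$, and $a\circ b=a+e^{L_{\Omega(a)}}(b)$; for such $A$ this gives a brace $(A,+,\circ)$. A finite $p$-group $G$ ($p>2$) is powerful if $G'\le G^{p}=\langle g^{p}:g\in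 G\rangle$. *)

(* Defs.v *)
From HB Require Import structures.
From mathcomp Require Import all_boot all_order all_algebra.
Set Implicit Arguments. Unset Strict Implicit. Unset Printing Implicit Defensive.
Import GRing.Theory.
Local Open Scope ring_scope.

Section Defs.
Variable T : finZmodType.

Definition preLie (mul : T -> T -> T) : Prop :=
  [/\ (forall a, {morph mul a : x y / x + y}),
      (forall b, {morph mul^~ b : x y / x + y}) &
      (forall x y z, mul (mul x y) z - mul x (mul y z)
                   = mul (mul y x) z - mul y (mul x z))].

Definition left_nilpotent (mul : T -> T -> T) : Prop :=
  exists m : nat, forall (s : seq T) (a : T), size s = m -> foldr mul a s = 0.

Inductive prodn (mul : T -> T -> T) : nat -> T -> Prop :=
  | prodn1 a : prodn mul 1 a
  | prodnM i j x y : prodn mul i x -> prodn mul j y -> prodn mul (i + j)%N (mul x y).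

Definition strongly_nilpotent (mul : T -> T -> T) : Prop :=
  exists m : nat, forall k x, (m <= k)%N -> prodn mul k x -> x = 0.

Definition powerful_preLie (p : nat) (mul : T -> T -> T) : Prop :=
  forall a b, exists c, mul a b - mul b a = c *+ p.

(** x / k : multiplication by an inverse of k modulo #|T| (well defined
    when k is coprime to #|T|; it sends 0 to 0 in every case). *)
Definition invmod (k : nat) : nat :=
  odflt 0%N (omap val [pick m : 'I_#|T| | (m * k) %% #|T| == 1 %% #|T|]%N).
Definition ndiv (k : nat) (x : T) : T := x *+ invmod k.

(** Group of flows: e^{L_a}(b), W(a), Omega = W^{-1}, a o b. The sums are
    truncated at #|T|, beyond which all terms vanish for left nilpotent A. *)
Definition flows_exp (mul : T -> T -> T) (a b : T) : T :=
  \sum_(k < #|T|) ndiv (k`!) (iter k (mul a) b).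
Definition flows_W (mul : T -> T -> T) (a : T) : T :=
  \sum_(k < #|T|) ndiv (k.+1`!) (iter k (mul a) a).
Definition flows_Omega (mul : T -> T -> T) (a : T) : T :=
  odflt 0 [pick x | flows_W mul x == a].
Definition flows_circ (mul : T -> T -> T) (a b : T) : T :=
  a + flows_exp mul (flows_Omega mul a) b.

Definition is_group_op (circ : T -> T -> T) : Prop :=
  (forall a b c, circ a (circ b c) = circ (circ a b) c) /\
  exists e, (forall a, circ e a = a /\ circ a e = a) /\
            (forall a, exists b, circ a b = e /\ circ b a = e).

Definition is_brace (circ : T -> T -> T) : Prop :=
  is_group_op circ /\
  forall a b c, circ a (b + c) + a = circ a b + circ a c.

Definition gen_in (circ : T -> T -> T) (e : T) (S : T -> Prop) (x : T) : Prop :=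
  forall H : {set T}, e \in H ->
    (forall a b, a \in H -> b \in H -> circ a b \in H) ->
    (forall a b, a \in H -> circ b a = e -> b \in H) ->
    (forall a, S a -> a \in H) -> x \in H.

Definition is_commutator (circ : T -> T -> T) (e c : T) : Prop :=
  exists x y xi yi, [/\ circ xi x = e, circ yi y = e &
                        c = circ (circ xi yi) (circ x y)].

Definition is_ppower (circ : T -> T -> T) (e : T) (p : nat) (c : T) : Prop :=
  exists g, c = iter p (circ g) e.

Definition powerful_group (p : nat) (circ : T -> T -> T) : Prop :=
  forall e, (forall a, circ e a = a) ->
  forall x, gen_in circ e (is_commutator circ e) x ->
            gen_in circ e (is_ppower circ e p) x.

End Defs.

(* Main.v *)
(** Represent affine maps of A linearly on A x Z/p^(n+1). Multiplication by a
    pre-Lie element x becomes the nilpotent affine map l_x(b, t) = (x.b + t x, 0);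
    the pre-Lie identity says exactly that {l_x} is closed under commutators, and
    exp l_x = (e^(L_x), W(x)). So flows braces are the groups exp(g) for such Lie
    rings g, and the theorem is a Lazard correspondence in a nilpotent ring whose
    class is smaller than p.

    Baker-Campbell-Hausdorff is used only in the form "log(e^x e^y) - x - y lies
    in the ideal generated by commutators": z(t) = log(e^x e^(ty)) satisfies
    ((1 - e^(-ad z)) / ad z) z' = y, so its coefficients lie in g by induction.
    Conversely, for a group G of unipotent maps, the lower central series of the
    Lie ring generated by log G is approximated term by term by logarithms of
    elements of G, whence exp of the whole Lie ring is G. That the affine maps of
    a brace are unipotent is the fixed-point property of p-groups. *)
From HB Require Import structures.
Require Import Defs.
From mathcomp Require Import all_boot all_order all_algebra all_fingroup all_solvable.
From mathcomp Require Import zify.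
Set Implicit Arguments. Unset Strict Implicit. Unset Printing Implicit Defensive.
Import GRing.Theory.
Local Open Scope ring_scope.

(** * Truncated exponentials in filtered rings *)

(** Powerfulness takes the same form on both sides because exp turns multiples into powers: e^(pu) =
    (e^u)^p, so exp(pg) is the set of p-th powers and, by BCH inside pg, also a subgroup. What has
    to be compared is [g, g] lying in pg with group commutators lying in exp(pg). For this reason
    BCH is proved relative to a pair g, h of additive subgroups: one lemma serves the whole Lie
    ring, its multiples of p and the terms of a lower central series. The BCH coefficients are never
    computed; the differential equation divides by factorials up to the class, and these are
    invertible because n + 1 < p. Strong nilpotency has a separate cause: modulo p a powerful
    pre-Lie ring is commutative, hence associative, so every long bracketing reduces to a
    right-nested product and yields a factor p. *)

Section Subgroups.
Variable V : zmodType.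
Implicit Type P : V -> Prop.

Definition subgrp P := P 0 /\ forall x y, P x -> P y -> P (x - y).

Lemma subgrp0 P : subgrp P -> P 0. Proof. by case. Qed.
Lemma subgrpB P x y : subgrp P -> P x -> P y -> P (x - y).
Proof. by case=> _; apply. Qed.
Lemma subgrpN P x : subgrp P -> P x -> P (- x).
Proof. by move=> gP Px; rewrite -sub0r; apply: subgrpB => //; case: gP. Qed.
Lemma subgrpD P x y : subgrp P -> P x -> P y -> P (x + y).
Proof. by move=> gP Px Py; rewrite -[y]opprK; apply: subgrpB => //; apply: subgrpN. Qed.
Lemma subgrpMn P x k : subgrp P -> P x -> P (x *+ k).
Proof.
move=> gP Px; elim: k => [|k IH]; first by rewrite mulr0n; apply: subgrp0.
by rewrite mulrS; apply: subgrpD.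
Qed.
Lemma subgrp_sum P I (r : seq I) (Q : pred I) (E : I -> V) :
  subgrp P -> (forall i, Q i -> P (E i)) -> P (\sum_(i <- r | Q i) E i).
Proof.
move=> gP PE; apply: big_ind => //; first exact: subgrp0.
by move=> x y; apply: subgrpD.
Qed.

End Subgroups.
Arguments subgrp_sum {V P I r Q E}.
Arguments subgrpMn {V P x k}.

Lemma sum_triangle (V : nmodType) N (f : nat -> nat -> V) :
  (forall i j, (N <= i + j)%N -> f i j = 0) ->
  \sum_(i < N) \sum_(j < N) f i j = \sum_(m < N) \sum_(i < m.+1) f i (m - i)%N.
Proof.
move=> f0.
transitivity (\sum_(i < N) \sum_(m < N | (i <= m)%N) f i (m - i)%N).
  apply: eq_bigr => i _; have le_iN := ltnW (ltn_ord i).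
  rewrite -(big_mkord xpredT (f i)) (big_cat_nat (n := (N - i)%N)) //=; last by lia.
  rewrite [X in _ + X]big_nat_cond [X in _ + X]big1 ?addr0; last first.
    by move=> j /andP[/andP[? _] _]; apply: f0; lia.
  rewrite -(big_geq_mkord i N xpredT (fun m => f i (m - i)%N)).
  have -> : index_iota i N = index_iota (0 + i) N by rewrite add0n.
  rewrite big_addn; apply: eq_bigr => j _.
  by rewrite addnK.
rewrite (exchange_big_dep xpredT) //=; apply: eq_bigr => m _.
by rewrite (big_ord_widen_cond N xpredT (fun i => f i (m - i)%N)).
Qed.

Section TruncatedExp.
Variables (R : nzRingType) (n : nat) (c : nat -> nat).
Hypothesis cP : forall k, (k <= n)%N -> (c k * k`!)%:R = 1 :> R.
Implicit Types x y z e r : R.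

(** Division by k! is multiplication by a natural number [c k] inverting it, so the same
    coefficients serve in [R] and in [{poly R}]. *)
Definition rexp (x : R) := \sum_(k < n.+1) x ^+ k *+ c k.
Definition rbr (x y : R) := x * y - y * x.

Lemma mulrn_cK k x : (k <= n)%N -> x *+ (c k * k`!) = x.
Proof. by move=> /cP ck; rewrite -mulr_natl ck mul1r. Qed.

Lemma coef_c0 x : x *+ c 0 = x.
Proof. by rewrite -[RHS](@mulrn_cK 0) ?muln1. Qed.

Lemma coef_c1 x : (0 < n)%N -> x *+ c 1 = x.
Proof. by move=> n0; rewrite -[RHS](@mulrn_cK 1) ?muln1. Qed.

Lemma coef_cM i j x : (i + j <= n)%N ->
  x *+ (c i * c j) = x *+ ('C(i + j, i) * c (i + j)).
Proof.
move=> le_n.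
have E : 'C(i + j, i) * (i`! * j`!) = (i + j)`! by have := bin_fact (leq_addr j i); rewrite addKn.
rewrite -[LHS](@mulrn_cK (i + j)) // -E -!mulrnA.
have -> : (c i * c j * (c (i + j) * ('C(i + j, i) * (i`! * j`!))) =
  ('C(i + j, i) * c (i + j)) * (c i * i`!) * (c j * j`!))%N by lia.
rewrite mulrnA (@mulrn_cK j); last by lia.
by rewrite mulrnA (@mulrn_cK i) //; lia.
Qed.

(** Arbitrary sequences are allowed because this Cauchy product is applied to powers, to
    [u * v ^+ j] and to derivatives of powers; the vanishing hypothesis makes the truncation
    exact. *)
Lemma truncated_product (a b : nat -> R) :
  (forall i j, (n < i + j)%N -> a i * b j = 0) ->
  (\sum_(i < n.+1) a i *+ c i) * (\sum_(j < n.+1) b j *+ c j) =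
  \sum_(m < n.+1) (\sum_(i < m.+1) a i * b (m - i)%N *+ 'C(m, i)) *+ c m.
Proof.
move=> ab0; rewrite big_distrlr /=.
rewrite (@sum_triangle _ n.+1 (fun i j => (a i *+ c i) * (b j *+ c j))); last first.
  by move=> i j ij; rewrite mulrnAl mulrnAr ab0 // !mul0rn.
apply: eq_bigr => m _; rewrite -sumrMnl; apply: eq_bigr => i _.
have := ltn_ord i; have := ltn_ord m; rewrite !ltnS => mn im.
rewrite mulrnAl mulrnAr -!mulrnA mulnC coef_cM; last by lia.
by rewrite subnKC.
Qed.

(** Pascal's rule splits the sum into a shifted one and [- v] times the old one. The recursion turns
    the shift into right multiplication by [v], which completes a commutator, and the leftover
    collapses to [(v - v) ^+ m * w]. *)
Lemma binomial_cancel (v w : R) (b : nat -> R) :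
  (forall j, b j.+1 = b j * v + v ^+ j * w) ->
  forall m, \sum_(i < m.+2) (- v) ^+ i * b (m.+1 - i)%N *+ 'C(m.+1, i) =
    rbr (- v) (\sum_(i < m.+1) (- v) ^+ i * b (m - i)%N *+ 'C(m, i))
    + (if m == 0%N then w else 0).
Proof.
move=> bS m.
have pascal (d : nat -> R) : 
   \sum_(i < m.+2) (- v) ^+ i * d (m.+1 - i)%N *+ 'C(m.+1, i) =
   \sum_(i < m.+1) (- v) ^+ i * d (m - i).+1 *+ 'C(m, i)
   - v * (\sum_(i < m.+1) (- v) ^+ i * d (m - i)%N *+ 'C(m, i)).
  rewrite big_ord_recl /= bin0 subn0 expr0 mul1r.
  under eq_bigr => i _ do rewrite /bump /= add1n subSS binS mulrnDr.
  rewrite big_split /= addrA; congr (_ + _).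
    rewrite [RHS]big_ord_recl /= subn0 bin0 expr0 mul1r; congr (_ + _).
    rewrite big_ord_recr /= bin_small // mulr0n addr0; apply: eq_bigr => i _.
    by rewrite /bump /= add1n subnSK.
  rewrite -mulNr mulr_sumr; apply: eq_bigr => i _.
  by rewrite exprS mulrnAr mulrA.
rewrite pascal.
under eq_bigr => i _ do rewrite bS mulrDr mulrA mulrA mulrnDl.
rewrite big_split /=.
have -> : \sum_(i < m.+1) (- v) ^+ i * v ^+ (m - i) * w *+ 'C(m, i) = 
   if m == 0%N then w else 0.
  under eq_bigr => i _ do rewrite -mulrnAl.
  rewrite -mulr_suml.
  have cv : GRing.comm v (- v) by apply: commrN; apply: commr_refl.
  transitivity ((v - v) ^+ m * w).
    rewrite exprDn_comm //; congr (_ * w); apply: eq_bigr => i _.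
    by congr (_ *+ _); apply/commrX/commr_sym/commrX/commr_sym.
  by rewrite subrr expr0n; case: (m == 0%N); rewrite ?mul1r ?mul0r.
rewrite /rbr mulNr mulrN opprK [- _ + _]addrC.
rewrite mulr_suml -!addrA; congr (_ + _); last by rewrite addrC.
by apply: eq_bigr => i _; rewrite mulrnAl.
Qed.

Lemma iter_rbr_binomial (v u : R) m :
  \sum_(i < m.+1) (- v) ^+ i * (u * v ^+ (m - i)) *+ 'C(m, i) = iter m (rbr (- v)) u.
Proof.
elim: m => [|m IH]; first by rewrite big_ord1 /= expr0 mul1r mulr1.
rewrite (@binomial_cancel v 0 (fun j => u * v ^+ j)); last first.
  by move=> j; rewrite mulr0 addr0 exprSr mulrA.
by rewrite IH if_same addr0.
Qed.

(** Nilpotency is asked of [F 1] relative to a subring [F 0], so that [R] itself may be a full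
    endomorphism ring. *)
Record filtration (F : nat -> R -> Prop) : Prop := Filtration {
  fil_grp : forall k, subgrp (F k);
  filM : forall i j x y, F i x -> F j y -> F (i + j)%N (x * y);
  fil_le : forall i j x, (j <= i)%N -> F i x -> F j x;
  fil_top : forall x, F n.+1 x -> x = 0;
  fil1 : F 0%N 1 }.

Variable F : nat -> R -> Prop.
Hypothesis FP : filtration F.

Lemma filX x k : F 1%N x -> F k (x ^+ k).
Proof.
move=> Fx; elim: k => [|k IH]; first exact: (fil1 FP).
by rewrite exprS -add1n; apply: (filM FP).
Qed.

Lemma fil_top_le k x : (n < k)%N -> F k x -> x = 0.
Proof. by move=> nk Fx; apply: (fil_top FP); apply: (fil_le FP) Fx. Qed.

Lemma fil_rbr i j x y : F i x -> F j y -> F (i + j)%N (rbr x y).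
Proof.
move=> Fx Fy; apply: subgrpB; [exact: (fil_grp FP) | exact: (filM FP) |].
by rewrite addnC; apply: (filM FP).
Qed.

Lemma fil_iter_rbr x y k : F 1%N x -> F 1%N y -> F k.+1 (iter k (rbr x) y).
Proof.
move=> Fx Fy; elim: k => [|k IH] //=.
by rewrite -add1n; apply: fil_rbr.
Qed.

Lemma rexp0 : rexp 0 = 1.
Proof.
rewrite /rexp big_ord_recl expr0 coef_c0 big1 ?addr0 // => i _.
by rewrite exprS mul0r mul0rn.
Qed.

Lemma rexpE x : (0 < n)%N -> exists2 s, rexp x = 1 + x + s &
  s = \sum_(k < n.-1) x ^+ k.+2 *+ c k.+2.
Proof.
move=> n0; eexists; last by [].
rewrite /rexp; case: (n) n0 coef_c0 coef_c1 => // m _ E0 E1 /=.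
by rewrite !big_ord_recl /= expr0 E0 expr1 E1 // addrA.
Qed.

Lemma rexpD x y : F 1%N x -> F 1%N y -> GRing.comm x y ->
  rexp (x + y) = rexp x * rexp y.
Proof.
move=> Fx Fy cxy; rewrite [rexp x * _](@truncated_product (GRing.exp x) (GRing.exp y)).
  apply: eq_bigr => m _; congr (_ *+ _).
  rewrite addrC exprDn_comm; last exact: commr_sym.
  by apply: eq_bigr => i _; congr (_ *+ _); apply/commrX/commr_sym/commrX.
move=> i j ij; apply: fil_top_le ij _; apply: (filM FP); exact: filX.
Qed.

Lemma rexpNK x : F 1%N x -> rexp (- x) * rexp x = 1.
Proof.
move=> Fx; rewrite -rexpD ?addNr ?rexp0 //; first by apply: subgrpN => //; apply: (fil_grp FP).
by apply/commr_sym/commrN/commr_refl.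
Qed.

Lemma rexpKN x : F 1%N x -> rexp x * rexp (- x) = 1.
Proof.
move=> Fx; rewrite -{1}[x]opprK rexpNK //.
by apply: subgrpN => //; apply: (fil_grp FP).
Qed.

Lemma rexpMn x k : F 1%N x -> rexp (x *+ k) = rexp x ^+ k.
Proof.
move=> Fx; elim: k => [|k IH]; first by rewrite mulr0n rexp0 expr0.
rewrite mulrS exprS rexpD ?IH //; first by apply: subgrpMn => //; apply: (fil_grp FP).
by apply/commrMn/commr_refl.
Qed.

(** The truncated form of Ad(e^(-v)) = e^(-ad v). *)
Lemma rexp_conj u v : F 1%N u -> F 1%N v ->
  rexp (- v) * u * rexp v = \sum_(m < n.+1) iter m (rbr (- v)) u *+ c m.
Proof.
move=> Fu Fv; rewrite -mulrA {2}/rexp mulr_sumr.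
under [X in _ * X]eq_bigr => i _ do rewrite mulrnAr.
rewrite (@truncated_product (fun i => (- v) ^+ i) (fun j => u * v ^+ j)).
  by apply: eq_bigr => m _; rewrite iter_rbr_binomial.
move=> i j ij; apply: (@fil_top_le (i + (1 + j))%N); first by lia.
do 2?[apply: (filM FP) => //]; apply: filX => //.
by apply: subgrpN => //; apply: (fil_grp FP).
Qed.

Lemma telescope_expr (u v : R) k :
  u ^+ k - v ^+ k = \sum_(i < k) u ^+ i * (u - v) * v ^+ (k.-1 - i).
Proof.
elim: k => [|k IH]; first by rewrite big_ord0 !expr0 subrr.
rewrite big_ord_recr /= subnn mulr1.
have -> : u ^+ k.+1 - v ^+ k.+1 = (u ^+ k - v ^+ k) * v + u ^+ k * (u - v).
  by rewrite mulrBl mulrBr -!exprSr [RHS]addrC addrA subrK.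
rewrite IH mulr_suml; congr (_ + _); apply: eq_bigr => i _.
by rewrite -mulrA -exprSr; congr (_ * _ ^+ _); have := ltn_ord i; lia.
Qed.

(** In degree at least 2 each telescoped summand contains [r] and a further factor from [F 1], hence
    gains a step of the filtration. *)
Lemma rexp_approx k x r : (0 < n)%N -> (0 < k)%N -> F 1%N x -> F k r ->
  F k.+1 (rexp (x + r) - rexp x - r).
Proof.
move=> n0 k0 Fx Fr.
have Fr1 : F 1%N r by apply: (fil_le FP) Fr.
have Fxr : F 1%N (x + r) by apply: subgrpD => //; apply: (fil_grp FP).
have [s -> ->] := rexpE (x + r) n0; have [s' -> ->] := rexpE x n0.
set A := \sum_(_ < _) _; set B := \sum_(_ < _) _.
have -> : 1 + (x + r) + A - (1 + x + B) - r = A - B.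
  by rewrite addrA -(addrA _ r) opprD addrACA subrr add0r addrAC [r + A]addrC addrK.
rewrite -sumrB; apply: subgrp_sum => [|i _]; first exact: (fil_grp FP).
rewrite -mulrnBl; apply: subgrpMn; first exact: (fil_grp FP).
rewrite telescope_expr; apply: subgrp_sum => [|j _]; first exact: (fil_grp FP).
rewrite [x + r]addrC addrK.
apply: (@fil_le _ FP (j + k + (i.+2.-1 - j))%N); first by have := ltn_ord j; lia.
by do 2?[apply: (filM FP) => //]; apply: filX => //; rewrite addrC.
Qed.

(** Successive correction: adding the error [1 + e - rexp z] to [z] pushes the error one step
    deeper, until it vanishes. *)
Lemma rexp_surj e : (0 < n)%N -> F 1%N e -> exists2 z, F 1%N z & rexp z = 1 + e.
Proof.
move=> n0 Fe.
have step k : exists2 z, F 1%N z & F k.+1 (1 + e - rexp z).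
  elim: k => [|k [z Fz Fk]].
    by exists 0; rewrite ?rexp0 1?addrC ?addKr //; apply: subgrp0; apply: (fil_grp FP).
  have Fr : F 1%N (1 + e - rexp z) by apply: (fil_le FP) Fk.
  exists (z + (1 + e - rexp z)); first by apply: subgrpD => //; apply: (fil_grp FP).
  have := rexp_approx n0 (ltn0Sn k) Fz Fk.
  move=> /(subgrpN (fil_grp FP _)); rewrite !opprB; congr (F _).
  by rewrite addrA subrK.
have [z Fz /(fil_top FP) /eqP] := step n; rewrite subr_eq0 => /eqP ->.
by exists z.
Qed.

Lemma rexp_mul_surj x y : (0 < n)%N -> F 1%N x -> F 1%N y ->
  exists2 z, F 1%N z & rexp z = rexp x * rexp y.
Proof.
move=> n0 Fx Fy.
have E1 t : F 1%N t -> F 1%N (rexp t - 1).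
  move=> Ft; rewrite -[rexp t - 1](subrK t); apply: subgrpD => //; first exact: (fil_grp FP).
  have := rexp_approx n0 (ltn0Sn 0) (subgrp0 (fil_grp FP 1)) Ft.
  by rewrite add0r rexp0 => /(fil_le FP); apply.
have [||z Fz Ez] := @rexp_surj (rexp x * rexp y - 1) => //; last first.
  by exists z => //; rewrite Ez addrC subrK.
have -> : rexp x * rexp y - 1 = (rexp x - 1) * (rexp y - 1) + (rexp x - 1) + (rexp y - 1).
  by rewrite mulrBr mulr1 subrK mulrBl mul1r subrKA.
have FD := fil_grp FP 1; apply: subgrpD (E1 y Fy) => //; apply: subgrpD (E1 x Fx) => //.
exact: (fil_le FP) (filM FP (E1 x Fx) (E1 y Fy)).
Qed.

(** Equality of the exponentials makes [u - v] minus a combination of [u ^+ k - v ^+ k] with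
    [k >= 2]. Telescoping these raises the total exponent in [u ^+ i * (u - v) * v ^+ j], and from
    2(n + 1) on one outer power vanishes. No commutation of [u] and [v] is assumed. *)
Lemma rexp_inj u v : (0 < n)%N -> u ^+ n.+1 = 0 -> v ^+ n.+1 = 0 -> rexp u = rexp v -> u = v.
Proof.
move=> n0 u0 v0 euv.
have X0 (w : R) k : w ^+ n.+1 = 0 -> (n < k)%N -> w ^+ k = 0.
  by move=> w0 nk; rewrite -(subnKC nk) exprD w0 mul0r.
have key m i j : (n.+1.*2 <= i + j + m)%N -> u ^+ i * (u - v) * v ^+ j = 0.
  elim: m i j => [|m IH] i j ij.
    have [ni | ni] := ltnP n i; first by rewrite X0 // !mul0r.
    by rewrite [v ^+ j]X0 ?mulr0 //; lia.
  have [s Eu Es] := rexpE u n0; have [s' Ev Es'] := rexpE v n0.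
  have : rexp u - rexp v = 0 by rewrite euv subrr.
  rewrite Eu Ev opprD addrACA (opprD 1) (addrACA 1) subrr add0r.
  rewrite Es Es' -sumrB => /(congr1 (fun x => u ^+ i * x * v ^+ j)).
  rewrite mulr0 mul0r mulrDr mulrDl mulr_sumr mulr_suml big1 ?addr0 // => k _.
  rewrite -mulrnBl mulrnAr mulrnAl telescope_expr mulr_sumr mulr_suml big1 ?mul0rn // => l _.
  rewrite !mulrA -exprD -mulrA -exprD; apply: IH.
  by have := ltn_ord l; lia.
have := key n.+1.*2 0%N 0%N; rewrite !expr0 mul1r mulr1 => /(_ _)/eqP.
by rewrite subr_eq0 => /(_ (leqnn _))/eqP.
Qed.

End TruncatedExp.

(** * Baker-Campbell-Hausdorff modulo an ideal *)

Section BCH.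
Variables (R : nzRingType) (n : nat) (c : nat -> nat).
Hypothesis n_gt0 : (0 < n)%N.
Hypothesis cP : forall k, (k <= n)%N -> (c k * k`!)%:R = 1 :> R.
Variable F : nat -> R -> Prop.
Hypothesis FP : filtration n F.

Local Notation exp := (rexp n c).

Lemma rbr_is_additive (S : nzRingType) (x : S) : {morph rbr x : y z / y - z}.
Proof.
move=> y z; rewrite /rbr mulrBr mulrBl !opprB [z * x - _]addrC.
by rewrite addrACA [- (x * z) + _]addrC.
Qed.

Let cPpoly k : (k <= n)%N -> (c k * k`!)%:R = 1 :> {poly R}.
Proof. by move=> kn; rewrite -[RHS]polyC1 -(cP kn) rmorph_nat. Qed.

(** Requiring the coefficient of degree [i] to lie in [F i] as well kills all degrees above [n], so
    the filtration of [{poly R}] terminates at the same [n]. *)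
Definition pfil k (q : {poly R}) := forall i, F (maxn i k) q`_i.

Lemma pfil_filtration : filtration n pfil.
Proof.
split.
- move=> k; split=> [|p q Fp Fq] i; first by rewrite coef0; apply: subgrp0 (fil_grp FP _).
  by rewrite coefB; apply: subgrpB => //; apply: (fil_grp FP).
- move=> i j p q Fp Fq m; rewrite coefM; apply: subgrp_sum => [|k _]; first exact: (fil_grp FP).
  by apply: (fil_le FP) (filM FP (Fp _) (Fq _)); have := ltn_ord k; lia.
- by move=> i j q le_ji Fq k; apply: (fil_le FP) (Fq k); lia.
- move=> q Fq; apply/polyP => i; rewrite coef0; apply: (fil_top FP).
  by apply: (fil_le FP) (Fq i); lia.
- case=> [|i]; rewrite coef1 /=; first exact: (fil1 FP).
  exact: subgrp0 (fil_grp FP _).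
Qed.

Lemma pfil_deriv k q : pfil k q -> pfil k q^`().
Proof.
move=> Fq i; rewrite coef_deriv; apply: subgrpMn; first exact: (fil_grp FP).
by apply: (fil_le FP) (Fq i.+1); lia.
Qed.

(** The right side is the truncation of ((1 - e^(-ad z)) / ad z) z'. The binomial sum is 0 at index
    0; [binomial_cancel] produces z' at index 1 and one more bracket with [- z] at each later
    index. *)
Lemma deriv_rexp z : pfil 1 z ->
  exp (- z) * (exp z)^`() = \sum_(m < n) iter m (rbr (- z)) z^`() *+ c m.+1.
Proof.
move=> Fz; have PP := pfil_filtration.
rewrite {2}/rexp raddf_sum /=.
under [X in _ * X]eq_bigr => i _ do rewrite derivMn.
rewrite (@truncated_product _ n c cPpoly (fun i => (- z) ^+ i) (fun j => (z ^+ j)^`())); last first.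
  move=> i j ij; apply: (fil_top_le PP ij); apply: (filM PP).
    by apply: (filX PP); apply: (subgrpN (fil_grp PP 1) Fz).
  by apply: pfil_deriv; apply: (filX PP).
have d1 : (z ^+ 0)^`() = 0 by rewrite expr0 -polyC1 derivC.
rewrite big_ord_recl big_ord1 /= d1 mulr0 !mul0rn add0r.
apply: eq_bigr => m _; congr (_ *+ _); rewrite /bump leq0n add1n.
have bS j : (z ^+ j.+1)^`() = (z ^+ j)^`() * z + z ^+ j * z^`() by rewrite exprSr derivM.
elim: (nat_of_ord m) => [|k IH].
  rewrite (@binomial_cancel _ z z^`() (fun j => (z ^+ j)^`()) bS 0) /=.
  by rewrite big_ord1 /= d1 mulr0 mul0rn /rbr mulr0 mul0r subr0 add0r.
by rewrite (@binomial_cancel _ z z^`() (fun j => (z ^+ j)^`()) bS k.+1) /= addr0 IH.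
Qed.

Lemma rexp_horner (a : R) (q : {poly R}) : (forall r : {poly R}, comm_poly r a) ->
  (exp q).[a] = exp q.[a].
Proof.
move=> ca; rewrite /rexp horner_sum; apply: eq_bigr => i _.
by rewrite hornerMn horner_exp_comm.
Qed.

Lemma coef_rbr (p q : {poly R}) i : (rbr p q)`_i = \sum_(j < i.+1) rbr p`_j q`_(i - j).
Proof. by rewrite /rbr coefB coefM coefMr -sumrB. Qed.

(** The brackets required to lie in [h] are those of [g] with [y] and with [h]; [g, g] may be
    larger. This asymmetry makes the centralizer argument in [lcs_commutator] possible. *)
Lemma BCH (g h : R -> Prop) x y : subgrp g -> subgrp h ->
  (forall u, h u -> g u) -> (forall u, g u -> F 1%N u) -> g x -> g y ->
  (forall u, g u -> h (rbr u y)) -> (forall u w, g u -> h w -> h (rbr u w)) ->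
  exists2 z, h (z - (x + y)) & exp z = exp x * exp y.
Proof.
move=> gg gh hg gF gx gy hgy hgh; have PP := pfil_filtration.
have FX : pfil 1 x%:P.
  by case=> [|i]; rewrite coefC /=; [exact: gF | exact: subgrp0 (fil_grp FP _)].
(* The logarithm of e^x e^(ty) is [x] at t = 0 and the required element at t = 1. *)
set Y := y%:P * 'X; have FY : pfil 1 Y.
  case=> [|[|i]]; rewrite coefMX coefC /=; try exact: subgrp0 (fil_grp FP _).
  exact: gF.
have [z Fz Ez] := rexp_mul_surj cPpoly PP n_gt0 FX FY.
have z0 : z`_0 = x.
  apply: (rexp_inj cP n_gt0); do 1?[apply: (fil_top FP); apply: (filX FP)].
  - exact: Fz 0%N.
  - exact: gF.
  have := congr1 (fun q : {poly R} => q.[0]) Ez.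
  have comm0 (r : {poly R}) : comm_poly r 0 by rewrite /comm_poly mulr0 mul0r.
  rewrite hornerM_comm // !rexp_horner //.
  rewrite horner_coef0 hornerC /Y hornerMX mulr0 => ->.
  by rewrite rexp0 // mulr1.
have derY : (exp Y)^`() = exp Y * y%:P.
  have dY : Y^`() = y%:P by rewrite derivM derivC mul0r add0r derivX mulr1.
  have := deriv_rexp FY; move/(congr1 (fun q => exp Y * q)).
  rewrite mulrA (rexpKN cPpoly PP FY) mul1r => ->; congr (_ * _).
  case: (n) n_gt0 (coef_c1 cPpoly) => // m _ c1.
  rewrite big_ord_recl /= c1 // dY big1 ?addr0 // => i _.
  rewrite -iterS iterSr; have -> : rbr (- Y) y%:P = 0.
    rewrite /rbr mulNr mulrN opprK /Y -mulrA -commr_polyX mulrA addrC.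
    by rewrite -mulrA commr_polyX mulrA subrr.
  have -> k : iter k (rbr (- Y)) 0 = 0.
    by elim: k => //= k ->; rewrite /rbr mulr0 mul0r subrr.
  by rewrite mul0rn.
set D := z^`(); set a := rbr (- z).
have FD : pfil 1 D by apply: pfil_deriv.
have FNz : pfil 1 (- z) by apply: (subgrpN (fil_grp PP 1) Fz).
have ode : \sum_(m < n) iter m a D *+ c m.+1 = y%:P.
  rewrite -deriv_rexp // Ez derivM.
  have -> : exp x%:P = (exp x)%:P.
    rewrite /rexp rmorph_sum; apply: eq_bigr => i _.
    by rewrite rmorphMn rmorphXn.
  rewrite derivC mul0r add0r derY [X in _ * X]mulrA.
  have <- : exp z = (exp x)%:P * exp Y.
    rewrite Ez; congr (_ * _); rewrite /rexp rmorph_sum; apply: eq_bigr => i _.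
    by rewrite rmorphMn rmorphXn.
  by rewrite mulrA (rexpNK cPpoly PP Fz) mul1r.
have a0 : a 0 = 0 by rewrite /a /rbr mulr0 mul0r subrr.
have aB : {morph a : p q / p - q} by exact: rbr_is_additive.
have aD : {morph a : p q / p + q}.
  have aN q : a (- q) = - a q by rewrite -[- q]sub0r aB a0 sub0r.
  by move=> p q; rewrite -[q]opprK aB aN !opprK.
have odek k : \sum_(m < n) iter (k + m) a D *+ c m.+1 = iter k a y%:P.
  elim: k => [|k IH] //=; rewrite -IH (big_morph a aD a0); apply: eq_bigr => i _.
  by elim: (c i.+1) => [|l IHl]; rewrite ?mulr0n // !mulrS aD IHl.
have odeS k : iter k a D + \sum_(m < n.-1) iter (k + m.+1) a D *+ c m.+2 = iter k a y%:P.
  rewrite -odek; case: (n) n_gt0 (coef_c1 cPpoly) => // m _ c1.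
  by rewrite big_ord_recl /= c1 // addn0.
pose good d (q : {poly R}) := forall i, (i <= d)%N -> h q`_i.
have gg_good d : subgrp (good d).
  split=> [|p q gp gq] i id; first by rewrite coef0; apply: subgrp0.
  by rewrite coefB; apply: subgrpB => //; [apply: gp | apply: gq].
(* The coefficients of [ad(z)^k z'] up to degree [d] only involve those of [z] up to
   degree [d], and the equation then controls the coefficient of degree [d + 1]. *)
have gz d : forall i, (i <= d)%N ->
    if i == 0%N then z`_i = x else h (z`_i - (if i == 1%N then y else 0)).
  elim: d => [|d IH] i; first by rewrite leqn0 => /eqP ->.
  rewrite leq_eqVlt ltnS => /orP[/eqP -> /= |]; last exact: IH.
  have gzi j : (j <= d)%N -> g (- z`_j).
    move=> jd; apply: subgrpN => //; have := IH j jd.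
    case: (j == 0%N) => [->//|/hg hz]; rewrite -[z`_j](subrK (if j == 1%N then y else 0)).
    by apply: subgrpD => //; case: ifP => // _; apply: subgrp0.
  have good_a q : good d q -> good d (a q).
    move=> gq i' id'; rewrite coef_rbr; apply: subgrp_sum => // j _.
    by rewrite coefN; apply: hgh; [apply: gzi | apply: gq]; have := ltn_ord j; lia.
  have good_y k : good d (iter k.+1 a y%:P).
    elim: k => [|k IHk]; last exact: good_a.
    move=> i' id' /=; rewrite coef_rbr; apply: subgrp_sum => // j _.
    rewrite coefN coefC; case: ifP => _; last by rewrite /rbr mulr0 mul0r subrr; apply: subgrp0.
    by apply: hgy; apply: gzi; have := ltn_ord j; lia.
  (* Downward induction on the number of brackets: sufficiently many give 0, and the equation
     expresses fewer brackets through more. *)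
  have good_D m k : (n < k.+1 + m)%N -> good d (iter k.+1 a D).
    elim: m k => [|m IHm] k nk.
      rewrite addn0 in nk.
      rewrite (@fil_top_le _ _ _ PP _ _ _ (fil_iter_rbr PP k.+1 FNz FD)); last by lia.
      exact: subgrp0.
    have -> : iter k.+1 a D = iter k.+1 a y%:P - \sum_(l < n.-1) iter (k.+1 + l.+1) a D *+ c l.+2.
      by rewrite -odeS addrK.
    apply: (subgrpB (gg_good d)); first exact: good_y.
    apply: (subgrp_sum (gg_good d)) => l _; apply: (subgrpMn (gg_good d)).
    by rewrite addSn; apply: IHm; lia.
  have goodDy : good d (D - y%:P).
    have := odeS 0%N; rewrite [iter 0 a y%:P]/= => <-; rewrite opprD addrA subrr sub0r.
    apply: (subgrpN (gg_good d)).
    apply: (subgrp_sum (gg_good d)) => l _; apply: (subgrpMn (gg_good d)).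
    by rewrite add0n; apply: (good_D n); lia.
  have := goodDy d (leqnn d); rewrite coefB coefC /D coef_deriv.
  case: (d) => [|d'] //=; rewrite !subr0 => hz.
  (* The derivative controls [d'.+2] times the coefficient. Division by [d'.+2] is possible up to
     [n], and above [n] the coefficient is 0. *)
  have [d'n | nd'] := leqP d'.+2 n; last first.
    have -> : z`_d'.+2 = 0; last exact: subgrp0.
    by apply: (fil_top_le FP nd'); apply: (fil_le FP) (Fz _); lia.
  have -> : z`_d'.+2 = z`_d'.+2 *+ d'.+2 *+ (d'.+1`! * c d'.+2).
    rewrite -mulrnA -[LHS](mulrn_cK cP _ d'n); congr (_ *+ _).
    by rewrite factS; lia.
  exact: subgrpMn.
exists z.[1]; last first.
  have comm1 (r : {poly R}) : comm_poly r 1 by rewrite /comm_poly mulr1 mul1r.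
  by rewrite -rexp_horner // Ez hornerM_comm // !rexp_horner // hornerC /Y hornerMX hornerC mulr1.
rewrite (@horner_coef_wide _ (size z).+2); last by lia.
rewrite !big_ord_recl /= /bump /= !add1n !expr1n !mulr1 z0.
rewrite [x + y]addrC addrA opprD [- y - x]addrC addrA -[x + _ + _]addrA [x + _]addrC addrK.
rewrite addrAC; apply: subgrpD => //; first exact: (gz 1 1)%N.
apply: subgrp_sum => // i _; rewrite expr1n mulr1.
by have := gz _ _ (leqnn i.+2); rewrite /= subr0.
Qed.
End BCH.

(** * Groups of unipotents and Lie rings *)

Section Lazard.
Variables (R : nzRingType) (n : nat) (c : nat -> nat).
Hypothesis n_gt0 : (0 < n)%N.
Hypothesis cP : forall k, (k <= n)%N -> (c k * k`!)%:R = 1 :> R.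
Variable F : nat -> R -> Prop.
Hypothesis FP : filtration n F.

Local Notation exp := (rexp n c).

Lemma rbrNr (x y : R) : rbr x (- y) = - rbr x y.
Proof. by rewrite /rbr mulrN mulNr opprB opprK addrC. Qed.
Lemma rbrNl (x y : R) : rbr (- x) y = - rbr x y.
Proof. by rewrite /rbr mulrN mulNr opprB opprK addrC. Qed.
Lemma rbrC (x y : R) : rbr x y = - rbr y x.
Proof. by rewrite /rbr opprB. Qed.
Lemma rbrxx (x : R) : rbr x x = 0.
Proof. exact: subrr. Qed.
Lemma rbrDr (x y z : R) : rbr x (y + z) = rbr x y + rbr x z.
Proof. by rewrite -{1}[z]opprK rbr_is_additive rbrNr opprK. Qed.
Lemma rbrDl (x y z : R) : rbr (y + z) x = rbr y x + rbr z x.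
Proof. by rewrite rbrC rbrDr opprD -!rbrC. Qed.

Lemma F1N x : F 1%N x -> F 1%N (- x).
Proof. exact: subgrpN (fil_grp FP 1). Qed.

Lemma fil_rexp x : F 1%N x -> F 0%N (exp x).
Proof.
move=> Fx; apply: subgrp_sum => [|i _]; first exact: (fil_grp FP).
apply: subgrpMn; first exact: (fil_grp FP).
by apply: (fil_le FP) (filX FP _ Fx).
Qed.

Lemma rexp_conjN u v : F 1%N u -> F 1%N v ->
  exp (exp (- v) * u * exp v) = exp (- v) * exp u * exp v.
Proof.
move=> Fu Fv; have ab := rexpKN cP FP Fv; have ba := rexpNK cP FP Fv.
have conjX i : (exp (- v) * u * exp v) ^+ i = exp (- v) * u ^+ i * exp v.
  elim: i => [|i IH]; first by rewrite !expr0 mulr1.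
  by rewrite exprS IH !mulrA -[_ * exp v * exp (- v)]mulrA ab mulr1 -[_ * u * _]mulrA -exprS.
have expE (t : R) : exp t = \sum_(i < n.+1) t ^+ i *+ c i by [].
have lin (a b : R) (f : nat -> R) :
    a * (\sum_(i < n.+1) f i) * b = \sum_(i < n.+1) a * f i * b.
  by rewrite mulr_sumr mulr_suml.
rewrite (expE (_ * u * _)) (expE u) (lin _ _ (fun i => u ^+ i *+ c i)); apply: eq_bigr => i _.
by rewrite conjX mulrnAr mulrnAl.
Qed.

(** Modulo [h] the logarithm of a product is the sum of the logarithms, so the linear parts
    cancel. *)
Lemma commutator_rexp (g h : R -> Prop) x y : subgrp g -> subgrp h ->
  (forall u, h u -> g u) -> (forall u, g u -> F 1%N u) ->
  (forall u v, g u -> g v -> h (rbr u v)) -> g x -> g y ->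
  exists2 z, h z & exp z = exp (- x) * exp (- y) * (exp x * exp y).
Proof.
move=> gg gh hg gF gbr gx gy.
have gxN : g (- x) by apply: subgrpN.
have gyN : g (- y) by apply: subgrpN.
have gbr' u w : g u -> h w -> h (rbr u w) by move=> gu /hg; apply: gbr.
have bch s t : g s -> g t -> exists2 z, h (z - (s + t)) & exp z = exp s * exp t.
  by move=> gs gt; apply: (BCH n_gt0 cP FP gg gh) => // u gu; apply: gbr.
have [z1 hz1 <-] := bch _ _ gxN gyN; have [z2 hz2 <-] := bch _ _ gx gy.
have gz1 : g z1.
  by rewrite -[z1](subrK (- x - y)); apply: subgrpD; [|exact: hg|apply: subgrpD].
have gz2 : g z2.
  by rewrite -[z2](subrK (x + y)); apply: subgrpD; [|exact: hg|apply: subgrpD].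
have [z hz Ez] := bch _ _ gz1 gz2; exists z => //.
rewrite -[z](subrK (z1 + z2)); apply: subgrpD => //.
have -> : z1 + z2 = (z1 - (- x - y)) + (z2 - (x + y)).
  by rewrite -opprD opprK addrACA subrr addr0.
exact: subgrpD.
Qed.

(** Conjugating e^t by e^y multiplies it by an element of exp(h), so BCH gives e^(-ad y) t - t in
    [h] for every [t] in [g]. Taking iterated brackets for [t] and descending from those that vanish
    isolates the leading term - [y, t]. *)
Lemma rbr_of_commutators (g h : R -> Prop) : subgrp g -> subgrp h ->
  (forall u, h u -> g u) -> (forall u, g u -> F 1%N u) ->
  (forall u v, g u -> g v -> g (rbr u v)) ->
  (forall u v, g u -> h v -> h (rbr u v)) ->
  (forall x y, g x -> g y ->
     exists2 z, h z & exp z = exp (- x) * exp (- y) * (exp x * exp y)) ->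
  forall x y, g x -> g y -> h (rbr x y).
Proof.
move=> gg gh hg gF gbr hbr comm x y gx gy.
pose a := rbr (- y).
have giter k t : g t -> g (iter k a t).
  by move=> gt; elim: k => //= k IH; apply: gbr => //; apply: subgrpN.
have Fy := gF _ gy.
have expa t : g t -> h (\sum_(m < n) iter m.+1 a t *+ c m.+1).
  move=> gt; have Ft := gF _ gt; have [z hz Ez] := comm _ _ gt gy.
  have [||z' hz' Ez'] := BCH (x := t) (y := z) n_gt0 cP FP gg gh hg gF gt (hg _ hz).
  - by move=> u gu; apply: hbr.
  - exact: hbr.
  have Fz' : F 1%N z'.
    apply: gF; rewrite -[z'](subrK (t + z)); apply: subgrpD => //; first exact: hg.
    by apply: subgrpD => //; apply: hg.
  have Ec : exp (- y) * t * exp y = z'.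
    apply: (rexp_inj cP n_gt0); do 1?[apply: (fil_top FP); apply: (filX FP)] => //.
      by apply: (filM FP (filM FP (fil_rexp (F1N Fy)) Ft) (fil_rexp Fy)).
    by rewrite rexp_conjN // Ez' Ez !mulrA (rexpKN cP FP Ft) mul1r.
  have := rexp_conj cP FP Ft Fy; rewrite Ec big_ord_recl /= (coef_c0 cP) => E.
  have -> : \sum_(m < n) iter m.+1 a t *+ c m.+1 = (z' - (t + z)) + z.
    by rewrite E opprD addrA subrK addrAC subrr add0r.
  exact: subgrpD.
suff down m k t : (n < k.+1 + m)%N -> g t -> h (iter k.+1 a t).
  by rewrite rbrC -rbrNl; apply: (down n 0%N).
elim: m k t => [|m IH] k t nk gt.
  rewrite addn0 in nk.
  rewrite (fil_top_le FP (k := k.+2) _ (fil_iter_rbr FP k.+1 (F1N Fy) (gF _ gt))); last by lia.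
  exact: subgrp0.
have := expa _ (giter k _ gt).
case: (n) n_gt0 (coef_c1 cP) IH nk => // n' _ c1 IH nk.
rewrite big_ord_recl c1 //; set s := \sum_(_ < _) _ => hs.
have -> : iter k.+1 a t = (iter k.+1 a t + s) - s by rewrite addrK.
apply: subgrpB => //; apply: subgrp_sum => // i _; apply: subgrpMn => //.
by rewrite -iterD; apply: (IH (i.+1 + k)%N) => //; lia.
Qed.

Variable G : R -> Prop.
Hypothesis G1 : G 1.
Hypothesis GM : forall a b, G a -> G b -> G (a * b).
Hypothesis GV : forall a, G a -> exists2 b, G b & b * a = 1.

(* The Lie ring generated by the logarithms of [G], with its lower central series
   indexed from [0]. *)
Inductive lcs : nat -> R -> Prop :=
  | lcs_log u : F 1%N u -> G (exp u) -> lcs 0 u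
  | lcs0 k : lcs k 0
  | lcsB k x y : lcs k x -> lcs k y -> lcs k (x - y)
  | lcs_rbr i j x y : lcs i x -> lcs j y -> lcs (i + j).+1 (rbr x y)
  | lcsW k x : lcs k.+1 x -> lcs k x.

Lemma lcs_fil k x : lcs k x -> F k.+1 x.
Proof.
elim=> {k x} [u //|k|k x y _ Fx _ Fy|i j x y _ Fx _ Fy|k x _ Fx].
- exact: subgrp0 (fil_grp FP _).
- by apply: subgrpB => //; apply: (fil_grp FP).
- by have := fil_rbr FP Fx Fy; rewrite addSn addnS.
- exact: (fil_le FP) Fx.
Qed.

Lemma lcs_grp k : subgrp (lcs k).
Proof. by split; [exact: lcs0 | exact: lcsB]. Qed.

Lemma lcs_le i j x : (i <= j)%N -> lcs j x -> lcs i x.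
Proof.
by elim: j => [|j IH]; rewrite leq_eqVlt => /orP[/eqP->//|] //; rewrite ltnS => /IH ij /lcsW.
Qed.

Lemma lcs_F1 k x : lcs k x -> F 1%N x.
Proof. by move=> /lcs_fil; apply: (fil_le FP). Qed.

Lemma lcs_rbr_le i j k x y : (k <= (i + j).+1)%N -> lcs i x -> lcs j y -> lcs k (rbr x y).
Proof. by move=> le_k Lx Ly; apply: lcs_le le_k _; apply: lcs_rbr. Qed.

Lemma G_rexpN u : F 1%N u -> G (exp u) -> G (exp (- u)).
Proof.
move=> Fu /GV[b Gb bu]; suff -> : exp (- u) = b by [].
by rewrite -[RHS]mulr1 -(rexpKN cP FP Fu) mulrA bu mul1r.
Qed.

Lemma lcs_BCH k u v : lcs k u -> lcs k v ->
  exists2 w, lcs k.+1 (w - (u + v)) & exp w = exp u * exp v.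
Proof.
move=> Lu Lv; apply: (BCH n_gt0 cP FP (lcs_grp k) (lcs_grp k.+1)) => //.
- exact: lcsW.
- exact: lcs_F1.
- by move=> t Lt; apply: lcs_rbr_le Lt Lv; lia.
- by move=> t s Lt Ls; apply: lcs_rbr_le Lt Ls; lia.
Qed.

(** The commutator is e^(-u) e^(u') with u' = e^(-ad v) u = u + [u, v] + deeper terms. *)
Lemma lcs_commutator i j u v : lcs i u -> lcs j v ->
  exists2 w, lcs (i + j).+2 (w - rbr u v) &
    exp w = exp (- u) * (exp (- v) * exp u * exp v).
Proof.
move=> Lu Lv; have [Fu Fv] := (lcs_F1 Lu, lcs_F1 Lv).
have LvN : lcs j (- v) := subgrpN (lcs_grp j) Lv.
have LuN : lcs i (- u) := subgrpN (lcs_grp i) Lu.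
set u' := exp (- v) * u * exp v; pose t := u' - u.
have Lh := lcs_grp (i + j).+2; have Lh1 := lcs_grp (i + j).+1.
have Lt2 : lcs (i + j).+2 (t - rbr u v).
  rewrite /t /u' (rexp_conj cP FP) // rbrC -rbrNl.
  case: (n) n_gt0 (coef_c0 cP) (coef_c1 cP) => // n' _ c0 c1.
  rewrite !big_ord_recl /= c0 c1 // (addrAC u) subrr add0r addrAC subrr add0r.
  apply: subgrp_sum => // k _; apply: subgrpMn => //.
  have Lk : lcs i (iter k (rbr (- v)) u).
    by elim: (nat_of_ord k) => //= m IH; apply: lcs_rbr_le LvN IH; lia.
  by apply: lcs_rbr_le LvN (lcs_rbr LvN Lk); lia.
have Lt : lcs (i + j).+1 t.
  by rewrite -[t](subrK (rbr u v)); apply: subgrpD => //; [exact: lcsW | exact: lcs_rbr].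
have L0 k x : lcs k x -> lcs 0 x by apply: lcs_le.
(* BCH is applied inside the centralizer of [u] modulo the target term: brackets with
   [u] of general elements of [lcs 0] do not lie deep enough. *)
pose g x := lcs 0 x /\ lcs (i + j).+2 (rbr x u).
have gg : subgrp g.
  split; first by split; rewrite /rbr ?mul0r ?mulr0 ?subrr; exact: lcs0.
  move=> x y [Lx hx] [Ly hy]; split; first exact: lcsB.
  by rewrite rbrDl rbrNl; apply: lcsB.
have hg x : lcs (i + j).+2 x -> g x.
  by move=> Lx; split; [exact: L0 Lx | apply: lcs_rbr_le Lx Lu; lia].
have gF x : g x -> F 1%N x by case=> /lcs_F1.
have gu : g u by split; [exact: L0 Lu | rewrite rbrxx; exact: lcs0].
have gt : g t by split; [exact: L0 Lt | apply: lcs_rbr_le Lt Lu; lia].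
have [||||w hw Ew] := BCH (x := - u) (y := u') n_gt0 cP FP gg Lh hg gF.
- exact: subgrpN.
- by rewrite -[u'](subrK u); apply: subgrpD.
- move=> x [Lx hx]; rewrite -[u'](subrK u) rbrDr; apply: subgrpD => //.
  by apply: lcs_rbr_le Lx Lt; lia.
- by move=> x y [Lx _] Ly; apply: lcs_rbr_le Lx Ly; lia.
exists w; last by rewrite Ew rexp_conjN.
rewrite -[w](subrK (- u + u')) -addrA; apply: subgrpD => //.
by rewrite [- u + _]addrC.
Qed.

(** Each constructor of [lcs] has a counterpart in the group: a difference is matched by the
    quotient of the approximants, a bracket by their commutator, and an element already one level
    deeper by 0. *)
Lemma lcs_approx k x : lcs k x ->
  exists u, [/\ lcs k u, G (exp u) & lcs k.+1 (x - u)].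
Proof.
have zero l : [/\ lcs l 0, G (exp 0) & lcs l.+1 (0 - 0)].
  by rewrite (rexp0 cP) subrr; split=> //; exact: lcs0.
elim=> {k x} [u Fu Gu|k|k x y Lx [u [Lu Gu xu]] Ly [v [Lv Gv yv]]
             |i j x y Lx [u [Lu Gu xu]] Ly [v [Lv Gv yv]]|k x Lx _].
- by exists u; rewrite subrr; split=> //; [exact: lcs_log | exact: lcs0].
- by exists 0.
- have [w Lw Ew] := lcs_BCH Lu (subgrpN (lcs_grp k) Lv).
  exists w; split.
  + rewrite -[w](subrK (u - v)); apply: subgrpD; [exact: lcs_grp|exact: lcsW|exact: lcsB].
  + by rewrite Ew; apply: GM => //; apply: G_rexpN => //; exact: lcs_F1 Lv.
  + have -> : x - y - w = ((x - u) - (y - v)) - (w - (u - v)).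
      rewrite !opprB [v - y]addrC (addrACA x) [- u + v]addrC (addrA _ (u - v)).
      by congr (_ - _); rewrite -addrA (addrA (v - u)) subrK subrr addr0.
    by apply: lcsB => //; apply: lcsB.
- have [w Lw Ew] := lcs_commutator Lu Lv.
  have [Fu Fv] := (lcs_F1 Lu, lcs_F1 Lv).
  exists w; split.
  + rewrite -[w](subrK (rbr u v)); apply: subgrpD; [exact: lcs_grp|exact: lcsW|exact: lcs_rbr].
  + by rewrite Ew; do 3?[apply: GM => //]; apply: G_rexpN.
  + have -> : rbr x y - w = rbr (x - u) y + rbr u (y - v) - (w - rbr u v).
      by rewrite rbr_is_additive rbrDl rbrNl subrKA (opprB w) subrKA.
    apply: lcsB => //; apply: subgrpD; first exact: lcs_grp.
      by apply: lcs_rbr_le xu Ly; lia.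
    by apply: lcs_rbr_le Lu yv; lia.
- by exists 0; have [L0 G0 _] := zero k; rewrite subr0; split.
Qed.

(** Stripping the approximant off [x] leaves a logarithm one level deeper; in the end only e^0
    remains. *)
Lemma lcs_G k x : lcs k x -> G (exp x).
Proof.
have [m] := ubnP (n - k)%N; elim: m k x => // m IH k x km Lx.
have [nk|kn] := leqP n k.
  by rewrite (fil_top_le FP (k := k.+1) _ (lcs_fil Lx)) ?(rexp0 cP).
have [u [Lu Gu xu]] := lcs_approx Lx.
have LuN : lcs k (- u) := subgrpN (lcs_grp k) Lu.
have [w Lw Ew] := lcs_BCH LuN Lx.
have -> : exp x = exp u * exp w.
  by rewrite Ew mulrA (rexpKN cP FP (lcs_F1 Lu)) mul1r.
apply: GM => //; apply: (IH k.+1); first by lia.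
rewrite -[w](subrK (- u + x)); apply: subgrpD => //; first exact: lcs_grp.
by rewrite addrC.
Qed.

End Lazard.

(** * Affine maps as endomorphisms *)

(* The factor [Z/q] is what affine maps of [T] act on linearly: [v \in T] is
   recorded as the image of [(0, 1)]. It also makes the ring nontrivial. *)
Record endo (T : finZmodType) (q : nat) := Endo {
  endo_fun :> {ffun T * 'Z_q -> T * 'Z_q};
  endo_additive : 
    [forall x : T * 'Z_q, forall y : T * 'Z_q,
      endo_fun (x - y)%R == (endo_fun x - endo_fun y)%R :> T * 'Z_q] }.

HB.instance Definition _ T q := [isSub for @endo_fun T q].
HB.instance Definition _ T q := [Choice of endo T q by <:].

Section EndoRing.
Variables (T : finZmodType) (q : nat).
Local Notation M := (T * 'Z_q)%type.
Local Notation R := (endo T q).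

Lemma endoP (f g : R) : (forall m, f m = g m) -> f = g.
Proof. by move=> fg; apply/val_inj/ffunP. Qed.

Lemma endoB (f : R) (x y : M) : f (x - y) = f x - f y.
Proof. by have /forallP/(_ x)/forallP/(_ y)/eqP := endo_additive f. Qed.
Lemma endo0 (f : R) : f 0 = 0.
Proof. by rewrite -[X in f X](subrr 0) endoB subrr. Qed.
Lemma endoN (f : R) (x : M) : f (- x) = - f x.
Proof. by rewrite -sub0r endoB endo0 sub0r. Qed.
Lemma endoD (f : R) (x y : M) : f (x + y) = f x + f y.
Proof. by rewrite -[y]opprK endoB endoN !opprK. Qed.

(* Opaque, so that simplification does not unfold applications of endomorphisms. *)
Fact endo_of_fun (f : M -> M) (fB : forall x y, f (x - y) = f x - f y) :
  {g : R | forall m, g m = f m}.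
Proof.
have fB' : [forall x : M, forall y : M,
    finfun f (x - y)%R == (finfun f x - finfun f y)%R :> M].
  by apply/forallP => x; apply/forallP => y; rewrite !ffunE fB.
by exists (Endo fB') => m; rewrite ffunE.
Qed.

Definition mkendo f fB : R := sval (@endo_of_fun f fB).
Lemma mkendoE f fB m : @mkendo f fB m = f m.
Proof. exact: svalP (endo_of_fun fB) m. Qed.

Fact endo_zeroB : forall x y : M, (0 : M) = 0 - 0. Proof. by rewrite subrr. Qed.
Fact endo_oppB (f : R) : forall x y : M, - f (x - y) = - f x - - f y.
Proof. by move=> x y; rewrite endoB opprD. Qed.
Fact endo_addB (f g : R) :
  forall x y : M, f (x - y) + g (x - y) = (f x + g x) - (f y + g y).
Proof. by move=> x y; rewrite !endoB opprD addrACA. Qed.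
Fact endo_mulB (f g : R) : forall x y : M, f (g (x - y)) = f (g x) - f (g y).
Proof. by move=> x y; rewrite !endoB. Qed.

Definition endo_zero := @mkendo (fun=> 0) endo_zeroB.
Definition endo_opp f := mkendo (endo_oppB f).
Definition endo_add f g := mkendo (endo_addB f g).
Definition endo_one := @mkendo id (fun _ _ => erefl).
Definition endo_mul f g := mkendo (endo_mulB f g).

Fact endo_addA : associative endo_add.
Proof. by move=> f g h; apply: endoP => m; rewrite !mkendoE addrA. Qed.
Fact endo_addC : commutative endo_add.
Proof. by move=> f g; apply: endoP => m; rewrite !mkendoE addrC. Qed.
Fact endo_add0 : left_id endo_zero endo_add.
Proof. by move=> f; apply: endoP => m; rewrite !mkendoE add0r. Qed.
Fact endo_addN : left_inverse endo_zero endo_opp endo_add.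
Proof. by move=> f; apply: endoP => m; rewrite !mkendoE addNr. Qed.
HB.instance Definition _ :=
  GRing.isZmodule.Build R endo_addA endo_addC endo_add0 endo_addN.

Fact endo_mulA : associative endo_mul.
Proof. by move=> f g h; apply: endoP => m; rewrite !mkendoE. Qed.
Fact endo_mul1l : left_id endo_one endo_mul.
Proof. by move=> f; apply: endoP => m; rewrite !mkendoE. Qed.
Fact endo_mul1r : right_id endo_one endo_mul.
Proof. by move=> f; apply: endoP => m; rewrite !mkendoE. Qed.
Fact endo_mulDl : left_distributive endo_mul +%R.
Proof. by move=> f g h; apply: endoP => m; rewrite !mkendoE. Qed.
Fact endo_mulDr : right_distributive endo_mul +%R.
Proof. by move=> f g h; apply: endoP => m; rewrite !mkendoE endoD. Qed.
Fact endo_one_neq0 : endo_one != 0.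
Proof.
apply/eqP => /(congr1 (fun f : R => (f (0, 1)).2)).
by rewrite !mkendoE /= => /eqP; rewrite oner_eq0.
Qed.
HB.instance Definition _ := GRing.Zmodule_isNzRing.Build R
  endo_mulA endo_mul1l endo_mul1r endo_mulDl endo_mulDr endo_one_neq0.

Lemma endo0E m : (0 : R) m = 0. Proof. exact: mkendoE. Qed.
Lemma endo1E m : (1 : R) m = m. Proof. exact: mkendoE. Qed.
Lemma endoDE (f g : R) m : (f + g) m = f m + g m. Proof. exact: mkendoE. Qed.
Lemma endoNE (f : R) m : (- f) m = - f m. Proof. exact: mkendoE. Qed.
Lemma endoBE (f g : R) m : (f - g) m = f m - g m.
Proof. by rewrite endoDE endoNE. Qed.
Lemma endoME (f g : R) m : (f * g) m = f (g m). Proof. exact: mkendoE. Qed.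
Lemma endoMnE (f : R) m k : (f *+ k) m = f m *+ k.
Proof. by elim: k => [|k IH]; rewrite ?mulr0n ?endo0E // !mulrS endoDE IH. Qed.
Lemma endo_sumE (I : Type) (r : seq I) (P : pred I) (E : I -> R) m :
  (\sum_(i <- r | P i) E i) m = \sum_(i <- r | P i) E i m.
Proof.
apply: (big_morph (fun f : R => f m)); [by move=> f g; exact: endoDE | exact: endo0E].
Qed.
Lemma endoXE (f : R) k m : (f ^+ k) m = iter k f m.
Proof. by elim: k => [|k IH]; rewrite ?expr0 ?endo1E // exprS endoME IH. Qed.

Lemma rexp_endoE n c (f : R) m :
  rexp n c f m = \sum_(k < n.+1) iter k f m *+ c k.
Proof.
by rewrite endo_sumE; apply: eq_bigr => k _; rewrite endoMnE endoXE.
Qed.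

Lemma mulrn_Zq0 (v : T) : v *+ (0 : 'Z_q)%R = 0. Proof. by []. Qed.
Lemma mulrn_Zq1 (v : T) : v *+ (1 : 'Z_q)%R = v. Proof. by []. Qed.

Hypothesis q_gt1 : (1 < q)%N.
Hypothesis Tq : forall v : T, v *+ q = 0.

Lemma mulrn_Zq_add (v : T) (s t : 'Z_q) : v *+ (s + t : 'Z_q)%R = v *+ s + v *+ t.
Proof.
have E : (s + t : 'Z_q)%R = ((s + t)%N %% q)%N :> nat by congr (_ %% _)%N; rewrite Zp_cast.
by rewrite E -mulrnDr [in RHS](divn_eq (s + t) q) mulrnDr mulnC mulrnA Tq mul0rn add0r.
Qed.

Lemma mulrn_Zq_sub (v : T) (s t : 'Z_q) : v *+ (s - t : 'Z_q)%R = v *+ s - v *+ t.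
Proof. by apply/eqP; rewrite eq_sym subr_eq -mulrn_Zq_add subrK. Qed.

Lemma natr_endo_modq k l : k = l %[mod q] -> k%:R = l%:R :> R.
Proof.
have q0 : q%:R = 0 :> R.
  apply: endoP => -[b t]; rewrite endoMnE endo1E endo0E.
  apply/eqP; rewrite -pair_eqE /=.
  have E j : ((b, t) *+ j : M) = (b *+ j, t *+ j) by elim: j => // j IH; rewrite !mulrS IH.
  rewrite E /= Tq eqxx /=; apply/eqP.
  by rewrite -mulr_natl pchar_Zp // mul0r.
have kq (j : nat) : j%:R = (j %% q)%:R :> R.
  by rewrite {1}(divn_eq j q) natrD natrM q0 mulr0 add0r.
by move=> kl; rewrite kq kl -kq.
Qed.

Section Affine.
Variables (L : T -> T) (v : T) (e : nat).
Hypothesis LB : forall x y, L (x - y) = L x - L y.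

Fact affineB (x y : M) : (L (x - y).1 + v *+ (x - y).2, (x - y).2 *+ e)
  = (L x.1 + v *+ x.2, x.2 *+ e) - (L y.1 + v *+ y.2, y.2 *+ e) :> M.
Proof.
case: x y => [b t] [b' t'].
transitivity ((L b + v *+ t) - (L b' + v *+ t'), t *+ e - t' *+ e : 'Z_q); last by [].
congr (_, _); last exact: mulrnBl.
by rewrite [(_ - _).1]/(b - b') [(_ - _).2]/(t - t') LB mulrn_Zq_sub opprD addrACA.
Qed.
(** [e = 0] gives elements of the Lie ring, [e = 1] elements of the group. *)
Definition affine : R := mkendo affineB.
Lemma affineE b t : affine (b, t) = (L b + v *+ t, t *+ e).
Proof. exact: mkendoE. Qed.
End Affine.

End EndoRing.

(** * Inverse factorials modulo a power of p *)

Section Coefficients.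
Variables (p n : nat) (T : finZmodType).
Hypotheses (p_pr : prime p) (np : (n.+1 < p)%N) (cardT : #|T| = (p ^ n)%N).

Lemma mulrn_card (v : T) : v *+ #|T| = 0.
Proof. by rewrite -FinRing.zmodXgE -cardsT expg_cardG ?inE. Qed.

Lemma modulus_gt1 : (1 < p ^ n.+1)%N.
Proof. by rewrite -{1}(expn0 p) ltn_exp2l // prime_gt1. Qed.

Lemma mulrn_modulus (v : T) : v *+ (p ^ n.+1) = 0.
Proof. by rewrite expnSr -cardT mulrnA mulrn_card mul0rn. Qed.

(** The inverse supplied by Euler's theorem. The modulus [p ^ n.+1] kills [T] and stays above 1 when
    n = 0. *)
Definition fact_inv k := (k`! ^ (totient (p ^ n.+1)).-1)%N.

Lemma fact_inv0 : fact_inv 0 = 1%N. Proof. by rewrite /fact_inv fact0 exp1n. Qed.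
Lemma fact_inv1 : fact_inv 1 = 1%N. Proof. by rewrite /fact_inv exp1n. Qed.

Lemma coprime_fact k : (k <= n.+1)%N -> coprime k`! (p ^ n.+1).
Proof.
move=> kn; rewrite coprime_pexpr //.
elim: k kn => [|k IH] kn; first by rewrite fact0 coprime1n.
rewrite factS coprimeMl IH; last by apply: ltnW.
by rewrite coprime_sym prime_coprime // gtnNdvd //; lia.
Qed.

Lemma fact_invP k : (k <= n.+1)%N -> (fact_inv k * k`!) = 1 %[mod p ^ n.+1].
Proof.
move=> kn; rewrite -expnSr prednK ?Euler_exp_totient ?coprime_fact //.
by rewrite totient_gt0 expn_gt0 prime_gt0.
Qed.

Lemma fact_inv_endo k : (k <= n.+1)%N ->
  (fact_inv k * k`!)%:R = 1 :> endo T (p ^ n.+1).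
Proof.
move=> /fact_invP/(natr_endo_modq modulus_gt1 mulrn_modulus).
by rewrite mulr1n.
Qed.

Lemma fact_invK k (y : T) : (k <= n.+1)%N -> y *+ (fact_inv k * k`!) = y.
Proof.
move=> /fact_invP E; rewrite (divn_eq (fact_inv k * k`!) (p ^ n.+1)) E.
rewrite modn_small ?modulus_gt1 // mulrnDr mulnC mulrnA mulrn_modulus mul0rn.
by rewrite add0r.
Qed.

(** [ndiv] picks some inverse modulo [#|T|]; all such inverses act alike on [T], since [#|T|]
    annihilates it. *)
Lemma ndivE k (y : T) : (k <= n.+1)%N -> ndiv k`! y = y *+ fact_inv k.
Proof.
move=> kn; have cardT0 : (0 < #|T|)%N by rewrite cardT expn_gt0 prime_gt0.
have ck : (fact_inv k * k`!) = 1 %[mod #|T|].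
  have dq : (#|T| %| p ^ n.+1)%N by rewrite cardT expnSr dvdn_mulr.
  by rewrite -(modn_dvdm _ dq) (fact_invP kn) modn_dvdm.
rewrite /ndiv /invmod; case: pickP => [m /eqP Em | /(_ (Ordinal (ltn_pmod (fact_inv k) cardT0)))].
  have -> : y *+ odflt 0%N (omap val (Some m)) = y *+ (m * k`!) *+ fact_inv k.
    by rewrite /= -[LHS](fact_invK _ kn) -!mulrnA; congr (_ *+ _); lia.
  congr (_ *+ _).
  rewrite (divn_eq (m * k`!) #|T|) Em mulrnDr mulnC mulrnA mulrn_card mul0rn add0r.
  (* In the trivial group [1 %% #|T|] is 0, and so is [y]. *)
  by case: (#|T|) (mulrn_card y) => [|[|l]] // y0; rewrite modn1 mulr0n -y0.
by rewrite /= modnMml ck eqxx.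
Qed.

End Coefficients.

(** * Ascending chains of subgroups in an abelian p-group *)

Section Ascending.
Variables (p n : nat) (T : finZmodType) (delta : T -> T -> T).
Hypotheses (p_pr : prime p) (cardT : #|T| = (p ^ n)%N).
Hypothesis deltaB : forall a x y, delta a (x - y) = delta a x - delta a y.

(** An analogue of the upper central series; [delta a b] will be the pre-Lie product, and for a
    brace lambda_a(b) - b. *)
Definition ascend (Z : {set T}) := [set b | [forall a, delta a b \in Z]].
Definition asc i := iter i ascend [set 0].

Lemma ascP i b : reflect (forall a, delta a b \in asc i) (b \in asc i.+1).
Proof. by rewrite inE; apply: forallP. Qed.

Lemma asc_grp i : subgrp (fun x => x \in asc i).
Proof.
elim: i => [|i [Z0 ZB]]; first by split=> [|x y]; rewrite !inE // => /eqP-> /eqP->; rewrite subrr.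
split=> [|x y /ascP Zx /ascP Zy]; apply/ascP => a; last by rewrite deltaB; apply: ZB.
by have := deltaB a 0 0; rewrite !subrr => ->.
Qed.

Lemma asc_subS i : asc i \subset asc i.+1.
Proof.
elim: i => [|i IH].
  apply/subsetP => x; rewrite inE => /eqP ->; exact: subgrp0 (asc_grp 1).
by apply/subsetP => x /ascP Zx; apply/ascP => a; apply: (subsetP IH).
Qed.

Lemma asc_group_set i : group_set (asc i).
Proof.
apply/group_setP; split; first exact: subgrp0 (asc_grp i).
by move=> x y Zx Zy; apply: (subgrpD (asc_grp i)).
Qed.
Canonical asc_group i := Group (asc_group_set i).

Lemma card_asc_pnat i : exists e, #|asc i| = (p ^ e)%N.
Proof.
have := cardSg (subsetT (asc_group i)); rewrite cardsT cardT.
by move=> /dvdn_pfactor[//|e _ ->]; exists e.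
Qed.

(** The orders are powers of [p], so each strict inclusion costs a factor [p], and [p ^ n] has room
    for [n] of them. *)
Lemma asc_top : (forall i, asc i != setT -> asc i.+1 != asc i) ->
  forall i, (n <= i)%N -> asc i = setT.
Proof.
move=> strict i ni; apply/eqP; apply: contraT => nT.
have nTj j : (j <= i)%N -> asc j != setT.
  move=> ji; apply: contra nT => /eqP Zj; rewrite -subTset -Zj.
  elim: i ji {ni} => [|i IH]; first by rewrite leqn0 => /eqP ->.
  rewrite leq_eqVlt => /orP[/eqP -> //|]; rewrite ltnS => /IH.
  by move/subset_trans; apply; exact: asc_subS.
have: (p ^ i <= #|asc i|)%N.
  elim: (i) nTj => [|j IH] nTj; first by rewrite cards1.
  have lt : (#|asc j| < #|asc j.+1|)%N.
    apply: proper_card; rewrite properEneq asc_subS andbT eq_sym.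
    by apply: strict; apply: nTj.
  have := IH (fun k kj => nTj k (leqW kj)); move: lt.
  have [e ->] := card_asc_pnat j; have [e' ->] := card_asc_pnat j.+1.
  by rewrite ltn_exp2l ?leq_exp2l ?prime_gt1 //; lia.
have : (#|asc i| < p ^ n)%N.
  by rewrite -cardT -cardsT; apply: proper_card; rewrite properEneq subsetT nT.
move=> /[swap] /leq_ltn_trans/[apply]; rewrite ltn_exp2l ?prime_gt1 //; lia.
Qed.

End Ascending.

(** * The filtration of affine maps induced by a flag *)

Section AffineFiltration.
Variables (n q : nat) (T : finZmodType) (Z : nat -> {set T}).
Hypotheses (q_gt1 : (1 < q)%N) (Tq : forall v : T, v *+ q = 0).
Hypothesis Z_grp : forall i, subgrp (fun x => x \in Z i).
Hypothesis Z0 : Z 0 = [set 0].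
Hypothesis ZS : forall i, Z i \subset Z i.+1.
Hypothesis ZT : forall i, (n <= i)%N -> Z i = setT.
Local Notation M := (T * 'Z_q)%type.
Local Notation R := (endo T q).

(** The chain [Z i] sits in T x 0 and the whole module is added at index [n.+1]. As [Z n] is [T],
    translation parts also lower the flag by one step. *)
Definition flag i (m : M) := m.1 \in Z i /\ (m.2 = 0 \/ (n < i)%N).
Definition flag_fil k (f : R) := forall i m, flag (i + k) m -> flag i (f m).

Lemma flag_grp i : subgrp (flag i).
Proof.
split=> [|x y [Zx tx] [Zy ty]].
  by split; [exact: subgrp0 (Z_grp i) | left].
split; first exact: subgrpB (Z_grp i) Zx Zy.
case: tx => [x0|]; last by right.
case: ty => [y0|]; last by right.
by left; rewrite /= x0 y0 subrr.
Qed.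

Lemma flag_le i j m : (i <= j)%N -> flag i m -> flag j m.
Proof.
move=> ij [Zm tm]; split; last by case: tm; [left | right; lia].
elim: j ij => [|j IH]; first by rewrite leqn0 => /eqP <-.
rewrite leq_eqVlt => /orP[/eqP <- //|]; rewrite ltnS => /IH.
exact: subsetP (ZS j) _.
Qed.

(** A map lowering the flag by [n.+2] sends everything into [flag 0], which is zero. The class
    [n.+1] is positive also for n = 0, as [rexp_surj] and [BCH] require. *)
Lemma flag_filtration : filtration n.+1 flag_fil.
Proof.
split.
- move=> k; split=> [|f g Ff Fg] i m im.
    by rewrite endo0E; exact: subgrp0 (flag_grp i).
  by rewrite endoBE; apply: subgrpB (flag_grp i) _ _; [apply: Ff | apply: Fg].
- move=> k l f g Ff Fg i m im; rewrite endoME; apply: (Ff i); apply: (Fg (i + k)%N).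
  by rewrite -addnA.
- by move=> k l f kl Ff i m im; apply: (Ff i); apply: flag_le im; rewrite leq_add2l.
- move=> f Ff; apply: endoP => m; rewrite endo0E.
  have [] := Ff 0%N m; first by split; [rewrite ZT ?inE //; lia | right; lia].
  rewrite Z0 inE; case: (f m) => [b t] /= /eqP -> [->|] //.
- by move=> i m; rewrite addn0 endo1E.
Qed.

Lemma flag_fil_affine0 (L : T -> T) v LB : (forall i b, b \in Z i.+1 -> L b \in Z i) ->
  flag_fil 1 (affine q_gt1 Tq v 0%N (L := L) LB).
Proof.
move=> LZ i [b t] [/= Zb tb]; rewrite addn1 in Zb tb; rewrite (affineE q_gt1 Tq v 0 LB).
split=> /=; last by left.
case: tb => [->|ni]; last by rewrite ZT ?inE.
by rewrite mulrn_Zq0 addr0; apply: LZ.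
Qed.

Lemma flag_fil_affine1 (L : T -> T) v LB :
  (forall i b, b \in Z i.+1 -> L b - b \in Z i) ->
  flag_fil 1 (affine q_gt1 Tq v 1%N (L := L) LB - 1).
Proof.
move=> LZ i [b t] [/= Zb tb]; rewrite addn1 in Zb tb.
rewrite endoBE endo1E (affineE q_gt1 Tq v 1 LB).
split=> /=; last by left; exact: subrr.
case: tb => [->|ni]; last by rewrite ZT ?inE.
by rewrite mulrn_Zq0 addr0; apply: LZ.
Qed.

Lemma flag_fil1_snd f m : flag_fil 1 f -> (f m).2 = 0.
Proof.
move=> Ff; have [|_ []//] := Ff n m; last by rewrite ltnn.
by split; [rewrite ZT ?inE ?leq_addr | right; rewrite addn1].
Qed.

End AffineFiltration.

(** * From pre-Lie rings to braces *)

Section EndoPairs.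
Variables (T : finZmodType) (q : nat).
Local Notation M := (T * 'Z_q)%type.
Local Notation R := (endo T q).
Definition vec (v : T) : M := (v, 0).
Definition unit_point : M := (0, 1).

Lemma vecB x y : vec (x - y) = vec x - vec y.
Proof. by transitivity (x - y, 0 - 0 : 'Z_q); first by rewrite subr0. Qed.
Lemma vec0 : vec 0 = 0. Proof. by []. Qed.
Lemma vecD x y : vec (x + y) = vec x + vec y.
Proof. by transitivity (x + y, 0 + 0 : 'Z_q); first by rewrite addr0. Qed.
Lemma vecMn x k : vec (x *+ k) = vec x *+ k.
Proof. by elim: k => [|k IH]; rewrite ?mulr0n // !mulrS vecD IH. Qed.
Lemma vec_sum (I : Type) (r : seq I) (P : pred I) (E : I -> T) :
  vec (\sum_(i <- r | P i) E i) = \sum_(i <- r | P i) vec (E i).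
Proof. exact: (big_morph vec vecD vec0). Qed.
Lemma vec_inj : injective vec. Proof. by move=> x y []. Qed.

Lemma pair_vec (b : T) (t : 'Z_q) : (b, t) = vec b + unit_point *+ t.
Proof.
have E k : unit_point *+ k = (0, k%:R).
  elim: k => [|k IH] //; rewrite !mulrS IH.
  by transitivity (0 + 0 : T, 1 + k%:R : 'Z_q); last by rewrite addr0.
rewrite E natr_Zp; transitivity (b + 0 : T, 0 + t : 'Z_q) => //.
by rewrite addr0 add0r.
Qed.

Lemma endo_ext (f g : R) :
  (forall b, f (vec b) = g (vec b)) -> f unit_point = g unit_point -> f = g.
Proof.
move=> fg fg1; have fMn (h : R) k : h (unit_point *+ k) = h unit_point *+ k.
  by elim: k => [|k IH]; rewrite ?endo0 // !mulrS endoD IH.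
by apply: endoP => -[b t]; rewrite pair_vec !endoD fg !fMn fg1.
Qed.

End EndoPairs.
Arguments unit_point {T q}.
Arguments vec {T q}.

Lemma sum_ord_trunc (V : nmodType) n A (f : nat -> V) : (n <= A)%N ->
  (forall k, (n <= k)%N -> f k = 0) -> \sum_(k < A) f k = \sum_(k < n) f k.
Proof.
move=> nA f0; rewrite -(big_mkord xpredT f) (big_cat_nat (n := n)) //= big_mkord.
rewrite [X in _ + X]big_nat_cond [X in _ + X]big1 ?addr0 //.
by move=> k /andP[/andP[nk _] _]; apply: f0.
Qed.

Section Flows.
Variables (p n : nat) (T : finZmodType) (mul : T -> T -> T).
Hypotheses (p_pr : prime p) (np : (n.+1 < p)%N) (cardT : #|T| = (p ^ n)%N).
Hypotheses (mulDr : forall a, {morph mul a : x y / x + y})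
           (mulDl : forall b, {morph mul^~ b : x y / x + y})
           (nil : left_nilpotent mul).

Local Notation q := (p ^ n.+1)%N.
Local Notation R := (endo T q).
Local Notation c := (fact_inv p n).
Local Notation exp := (rexp n.+1 c : R -> R).

Let q_gt1 := modulus_gt1 n p_pr.
Let Tq := mulrn_modulus cardT.
Let cP := fact_inv_endo p_pr np cardT.

Lemma mul_sub a x y : mul a (x - y) = mul a x - mul a y.
Proof. by apply/eqP; rewrite eq_sym subr_eq -mulDr subrK. Qed.
Lemma mul_subl a b x : mul (a - b) x = mul a x - mul b x.
Proof. by apply/eqP; rewrite eq_sym subr_eq -(mulDl x) subrK. Qed.
Lemma mul0x x : mul 0 x = 0.
Proof. by have := mul_subl 0 0 x; rewrite !subrr. Qed.
Lemma mulx0 x : mul x 0 = 0.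
Proof. by have := mul_sub x 0 0; rewrite !subrr. Qed.
Lemma mulMnr a x k : mul a (x *+ k) = mul a x *+ k.
Proof. by elim: k => [|k IH]; rewrite ?mulx0 // !mulrS mulDr IH. Qed.
Lemma mulMnl a x k : mul (a *+ k) x = mul a x *+ k.
Proof. by elim: k => [|k IH]; rewrite ?mul0x // !mulrS (mulDl x) IH. Qed.

(** A chain that stops growing is constant from there on, while left nilpotency puts every element
    into [asc mul m] for some [m]. *)
Lemma asc_mul_top i : (n <= i)%N -> asc mul i = setT.
Proof.
apply: (asc_top p_pr cardT mul_sub) => {}i; apply: contra => /eqP Zi.
have stable j : asc mul (j + i) = asc mul i.
  by elim: j => // j IH; rewrite addSn -[RHS]Zi /asc !iterS -!/(asc _ _) IH.
have [m mnil] := nil.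
have up j a : (forall s, size s = j -> foldr mul a s = 0) -> a \in asc mul j.
  elim: j a => [|j IH] a sa; first by rewrite inE; have /= -> := sa [::] erefl.
  apply/ascP => x; apply: IH => s ss; have := sa (rcons s x).
  by rewrite size_rcons ss foldr_rcons; apply.
rewrite -subTset -(stable m); apply/subsetP => a _.
have : a \in asc mul m by apply: up => s; apply: mnil.
elim: (i) => [|j IH]; first by rewrite addn0.
move=> /IH; rewrite addnS; exact: subsetP (asc_subS mul_sub _) _.
Qed.

Definition ell x : R := affine q_gt1 Tq x 0%N (mul_sub x).
Definition fil := flag_fil n (q := q) (asc mul).

Lemma fil_filtration : filtration n.+1 fil.
Proof.
apply: flag_filtration => //; [exact: asc_grp mul_sub | exact: asc_subS mul_sub|].
exact: asc_mul_top.
Qed.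
Let FP := fil_filtration.

Lemma ell_fil x : fil 1 (ell x).
Proof.
apply: flag_fil_affine0; first exact: asc_mul_top.
by move=> i b /ascP.
Qed.

Lemma ellE x b t : ell x (b, t) = vec (mul x b + x *+ t).
Proof. by rewrite (affineE q_gt1 Tq x 0 (mul_sub x)). Qed.
Lemma ell_vec x b : ell x (vec b) = vec (mul x b).
Proof. by rewrite ellE mulrn_Zq0 addr0. Qed.
Lemma ell_unit x : ell x unit_point = vec x.
Proof. by rewrite ellE mulrn_Zq1 mulx0 add0r. Qed.

Lemma ell_inj : injective ell.
Proof. by move=> x y /(congr1 (fun f : R => f unit_point)); rewrite !ell_unit => /vec_inj. Qed.

Lemma ellB x y : ell (x - y) = ell x - ell y.
Proof.
apply: endo_ext => [b|]; rewrite endoBE ?ell_vec ?ell_unit -vecB //.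
by rewrite mul_subl.
Qed.
Lemma ell0 : ell 0 = 0.
Proof. by have := ellB 0 0; rewrite !subrr. Qed.
Lemma ellN x : ell (- x) = - ell x.
Proof. by rewrite -sub0r ellB ell0 sub0r. Qed.
Lemma ellD x y : ell (x + y) = ell x + ell y.
Proof. by rewrite -[y]opprK ellB ellN !opprK. Qed.
Lemma ellMn x k : ell (x *+ k) = ell x *+ k.
Proof. by elim: k => [|k IH]; rewrite ?ell0 // !mulrS ellD IH. Qed.

Lemma iter_ell_vec x k b : iter k (ell x) (vec b) = vec (iter k (mul x) b).
Proof. by elim: k => //= k ->; rewrite ell_vec. Qed.

Lemma iter_mul0 x k b : (n <= k)%N -> iter k (mul x) b = 0.
Proof.
move=> nk; have : b \in asc mul k by rewrite asc_mul_top ?inE.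
elim: k b {nk} => [|k IH] b; first by rewrite inE => /eqP.
by rewrite iterSr => /ascP/(_ x)/IH.
Qed.

Let n_le_card : (n <= #|T|)%N.
Proof. by rewrite cardT ltnW // ltn_expl ?prime_gt1. Qed.

Lemma rexp_ell_vec x b : exp (ell x) (vec b) = vec (flows_exp mul x b).
Proof.
rewrite rexp_endoE; under eq_bigr do rewrite iter_ell_vec -vecMn.
rewrite -vec_sum /flows_exp; congr vec.
rewrite (@sum_ord_trunc _ n n.+2 (fun k => iter k (mul x) b *+ c k)) ?leqW //; last first.
  by move=> k nk; rewrite iter_mul0 // mul0rn.
rewrite (@sum_ord_trunc _ n #|T| (fun k => ndiv k`! (iter k (mul x) b))) //; last first.
  by move=> k nk; rewrite iter_mul0 // /ndiv mul0rn.
apply: eq_bigr => k _; rewrite (ndivE p_pr np cardT) //.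
by have := ltn_ord k; lia.
Qed.

Lemma rexp_ell_unit x : exp (ell x) unit_point = vec (flows_W mul x) + unit_point.
Proof.
rewrite rexp_endoE big_ord_recl /= fact_inv0 mulr1n addrC.
congr (_ + _).
under eq_bigr do rewrite /bump /= add1n -iterS iterSr ell_unit iter_ell_vec -vecMn.
rewrite -vec_sum /flows_W; congr vec.
rewrite (@sum_ord_trunc _ n n.+1 (fun k => iter k (mul x) x *+ c k.+1)) //; last first.
  by move=> k nk; rewrite iter_mul0 // mul0rn.
rewrite (@sum_ord_trunc _ n #|T| (fun k => ndiv k.+1`! (iter k (mul x) x))) //; last first.
  by move=> k nk; rewrite iter_mul0 // /ndiv mul0rn.
apply: eq_bigr => k _; rewrite (ndivE p_pr np cardT) //.
by have := ltn_ord k; lia.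
Qed.

Lemma rexp_ell_inj x y : exp (ell x) = exp (ell y) -> x = y.
Proof.
move=> /(rexp_inj cP (ltn0Sn n)) E; apply/ell_inj/E.
  by apply: (fil_top FP); apply: (filX FP); apply: ell_fil.
by apply: (fil_top FP); apply: (filX FP); apply: ell_fil.
Qed.

Lemma ell_nilpotent x : ell x ^+ n.+2 = 0.
Proof. by apply: (fil_top FP); apply: (filX FP); apply: ell_fil. Qed.

(** W(x) is x plus terms with more factors: applying L_x^k to W(x) = 0 gives L_x^k x = 0 once all
    higher powers vanish on x. *)
Lemma flows_W_eq0 x : flows_W mul x = 0 -> x = 0.
Proof.
have -> : flows_W mul x = \sum_(k < n.+1) iter k (mul x) x *+ c k.+1.
  have := rexp_ell_unit x; rewrite rexp_endoE big_ord_recl /= fact_inv0 mulr1n addrC.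
  move/addIr.
  under eq_bigr do rewrite /bump /= add1n -iterS iterSr ell_unit iter_ell_vec -vecMn.
  by rewrite -vec_sum => /vec_inj.
move=> W0; have down m k : (n <= k + m)%N -> iter k (mul x) x = 0; last by apply: (down n 0%N).
elim: m k => [|m IH] k; first by rewrite addn0; apply: iter_mul0.
move=> nk; have Lsum (f : 'I_n.+1 -> T) :
    iter k (mul x) (\sum_i f i) = \sum_i iter k (mul x) (f i).
  apply: big_morph => [y z|]; first by elim: k {nk} => //= k ->; rewrite mulDr.
  by elim: k {nk} => //= k ->; rewrite mulx0.
have LMn y j : iter k (mul x) (y *+ j) = iter k (mul x) y *+ j.
  by elim: k {nk Lsum} => //= k ->; rewrite mulMnr.
have := congr1 (iter k (mul x)) W0; rewrite Lsum.
under eq_bigr do rewrite LMn -iterD.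
rewrite big_ord_recl /= addn0 big1 => [|i _]; last first.
  by rewrite IH ?mul0rn // /bump; lia.
rewrite addr0 -[in X in _ = X -> _]/(iter 0 (mul x) 0).
have -> : iter k (mul x) 0 = 0 by elim: k {nk Lsum LMn} => //= k ->; rewrite mulx0.
by rewrite fact_inv1 mulr1n.
Qed.

Hypothesis mul_preLie : forall x y z,
  mul (mul x y) z - mul x (mul y z) = mul (mul y x) z - mul y (mul x z).

Lemma ell_rbr x y : rbr (ell x) (ell y) = ell (mul x y - mul y x).
Proof.
apply: endo_ext => [b|]; rewrite endoBE !endoME ?ell_vec ?ell_unit ?ell_vec -vecB //.
congr vec; rewrite mul_subl; apply/eqP.
rewrite eq_sym subr_eq addrAC -subr_eq opprK; apply/eqP.
have /eqP := mul_preLie x y b.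
by rewrite subr_eq addrAC => /eqP ->; rewrite subrK addrC.
Qed.

Definition ell_image (P : T -> Prop) (f : R) := exists2 x, P x & f = ell x.

Lemma ell_image_grp P : subgrp P -> subgrp (ell_image P).
Proof.
move=> gP; split=> [|f g [x Px ->] [y Py ->]].
  by exists 0; [exact: subgrp0 | rewrite ell0].
by exists (x - y); [exact: subgrpB | rewrite ellB].
Qed.

Lemma ell_image_rbr (P Q S : T -> Prop) :
  (forall x y, P x -> Q y -> S (mul x y - mul y x)) ->
  forall f g, ell_image P f -> ell_image Q g -> ell_image S (rbr f g).
Proof.
move=> PQS f g [x Px ->] [y Qy ->]; rewrite ell_rbr.
by exists (mul x y - mul y x); first exact: PQS.
Qed.

Definition allT (x : T) := True.
Definition pmult (x : T) := exists y, x = y *+ p.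

Lemma allT_grp : subgrp allT. Proof. by []. Qed.
Lemma pmult_grp : subgrp pmult.
Proof.
split; first by exists 0; rewrite mul0rn.
by move=> _ _ [x ->] [y ->]; exists (x - y); rewrite mulrnBl.
Qed.

Lemma ell_image_fil P f : ell_image P f -> fil 1 f.
Proof. by case=> x _ ->; apply: ell_fil. Qed.

Lemma ell_BCH x y : exists z, exp (ell z) = exp (ell x) * exp (ell y).
Proof.
have gA := ell_image_grp allT_grp.
have gM := @ell_image_rbr allT allT allT (fun _ _ _ _ => I).
have im z : ell_image allT (ell z) by exists z.
have [||z hz Ez] := @BCH _ n.+1 c (ltn0Sn n) cP fil FP (ell_image allT)
  (ell_image allT) (ell x) (ell y) gA gA (fun f h => h) (@ell_image_fil allT) (im x) (im y).
- by move=> f hf; apply: gM.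
- exact: gM.
have [z' _ Ez'] : ell_image allT z.
  by rewrite -[z](subrK (ell x + ell y)); apply: subgrpD => //; apply: subgrpD.
by exists z'; rewrite -Ez'.
Qed.

Lemma rexp_ellNK x : exp (ell (- x)) * exp (ell x) = 1.
Proof. by rewrite ellN (rexpNK cP FP (ell_fil x)). Qed.

(** If W x = W y, then e^(-l_x) e^(l_y) fixes [unit_point]. BCH writes it as e^(l_z), so W z = 0 and
    z = 0. *)
Lemma flows_W_inj : injective (flows_W mul).
Proof.
move=> x y Wxy; have [z Ez] := ell_BCH (- x) y.
have Eu : exp (ell y) unit_point = exp (ell x) unit_point by rewrite !rexp_ell_unit Wxy.
have := rexp_ell_unit z; rewrite Ez endoME Eu -endoME rexp_ellNK endo1E.
rewrite -[X in X = _]add0r => /addIr; rewrite -vec0 => /vec_inj/esym/flows_W_eq0 z0.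
apply: rexp_ell_inj; have := Ez; rewrite z0 ell0 (rexp0 cP) => E1.
have K := rexpKN cP FP (ell_fil x).
by rewrite -[LHS]mulr1 E1 mulrA ellN K mul1r.
Qed.

Lemma flows_OmegaK : cancel (flows_Omega mul) (flows_W mul).
Proof.
move=> a; rewrite /flows_Omega; case: pickP => [x /eqP //|no].
by have /eqP := f_invF flows_W_inj a; rewrite no.
Qed.
Lemma flows_WK : cancel (flows_W mul) (flows_Omega mul).
Proof. by move=> x; apply: flows_W_inj; rewrite flows_OmegaK. Qed.

Definition flow a : R := exp (ell (flows_Omega mul a)).

Lemma flow_vec a b : flow a (vec b) = vec (flows_circ mul a b - a).
Proof. by rewrite /flow rexp_ell_vec /flows_circ addrAC subrr add0r. Qed.
Lemma flow_unit a : flow a unit_point = vec a + unit_point.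
Proof. by rewrite /flow rexp_ell_unit flows_OmegaK. Qed.
Lemma flow_point a b : flow a (vec b + unit_point) = vec (flows_circ mul a b) + unit_point.
Proof. by rewrite endoD flow_vec flow_unit addrA -vecD subrK. Qed.
Lemma flow_inj : injective flow.
Proof.
move=> a b /(congr1 (fun f : R => f unit_point)).
by rewrite !flow_unit => /addIr/vec_inj.
Qed.

Lemma flowW x : flow (flows_W mul x) = exp (ell x).
Proof. by rewrite /flow flows_WK. Qed.

Lemma flowM a b : flow (flows_circ mul a b) = flow a * flow b.
Proof.
have [z Ez] := ell_BCH (flows_Omega mul a) (flows_Omega mul b).
have Wz : flows_W mul z = flows_circ mul a b.
  have := congr1 (fun f : R => f unit_point) Ez.
  by rewrite rexp_ell_unit endoME -/(flow b) flow_unit -/(flow a) flow_point => /addIr/vec_inj.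
by rewrite -Wz flowW.
Qed.

Lemma flow0 : flow 0 = 1.
Proof.
have W0 : flows_W mul 0 = 0.
  by have := rexp_ell_unit 0; rewrite ell0 (rexp0 cP) endo1E -[X in X = _]add0r => /addIr/vec_inj.
by rewrite -{1}W0 flowW ell0 (rexp0 cP).
Qed.

Lemma flowV a : exists2 b, flow b * flow a = 1 & flow a * flow b = 1.
Proof.
exists (flows_W mul (- flows_Omega mul a)); rewrite flowW.
  exact: rexp_ellNK.
by rewrite ellN (rexpKN cP FP (ell_fil _)).
Qed.

Lemma flows_circ_brace : is_brace (flows_circ mul).
Proof.
split; first split.
- by move=> a b d; apply: flow_inj; rewrite !flowM mulrA.
- exists 0; split=> a.
    by split; apply: flow_inj; rewrite flowM flow0 ?mul1r ?mulr1.
  by have [b ba ab] := flowV a; exists b; split; apply: flow_inj; rewrite flowM flow0.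
move=> a b d; have E x : vec (flows_circ mul a x) = flow a (vec x) + vec a.
  by rewrite flow_vec -vecD subrK.
apply: (@vec_inj T q); rewrite (vecD _ (flows_circ mul a (b + d))) (vecD _ (flows_circ mul a b)).
by rewrite !E (vecD _ b) endoD [RHS]addrACA addrA.
Qed.

Definition pflow a := exists w, flow a = exp (ell (w *+ p)).

(** BCH with [g] and [h] both the image of pT makes [pflow] a subgroup. The operation stays abstract
    so that [flows_circ mul] and a given brace product are both covered. *)
Lemma pflow_gen circ S x : (forall a b, flow (circ a b) = flow a * flow b) ->
  (forall a, S a -> pflow a) -> gen_in circ 0 S x -> pflow x.
Proof.
move=> circM Sp Hx; have gP := ell_image_grp pmult_grp.
have rP := @ell_image_rbr pmult pmult pmult.
pose H := [set a | [exists w, flow a == exp (ell (w *+ p))]].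
have HP a : reflect (pflow a) (a \in H).
  by rewrite inE; apply: (iffP existsP) => -[w /eqP]; exists w => //; apply/eqP.
apply/HP; apply: Hx.
- by apply/HP; exists 0; rewrite flow0 mul0rn ell0 (rexp0 cP).
- move=> a b /HP[u Eu] /HP[v Ev]; apply/HP.
  have im w : ell_image pmult (ell (w *+ p)) by exists (w *+ p) => //; exists w.
  have br f g : ell_image pmult f -> ell_image pmult g -> ell_image pmult (rbr f g).
    apply: rP => _ _ [y ->] [z ->]; exists (mul y (z *+ p) - mul z (y *+ p)).
    by rewrite mulrnBl -!mulMnl.
  have [||z hz Ez] := @BCH _ n.+1 c (ltn0Sn n) cP fil FP (ell_image pmult)
    (ell_image pmult) _ _ gP gP (fun f h => h) (@ell_image_fil pmult) (im u) (im v).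
  + by move=> f hf; apply: br.
  + exact: br.
  have [_ [w ->] Ew] : ell_image pmult z.
    rewrite -[z](subrK (ell (u *+ p) + ell (v *+ p))).
    by apply: subgrpD => //; apply: subgrpD.
  by exists w; rewrite -Ew Ez circM Eu Ev.
- move=> a b /HP[u Eu] ba; apply/HP; exists (- u).
  rewrite mulNrn ellN -[LHS]mulr1 -(rexpKN cP FP (ell_fil (u *+ p))) -Eu mulrA -circM ba.
  by rewrite flow0 mul1r.
- by move=> a /Sp/HP.
Qed.

Lemma rexp_ellX w k : exp (ell w) ^+ k = exp (ell (w *+ k)).
Proof. by rewrite ellMn (rexpMn cP FP _ (ell_fil w)). Qed.

(** The p-th power of e^(l_w) is e^(l_(pw)), and every element of the group is some e^(l_w). *)
Lemma pflowP circ a : (forall a b, flow (circ a b) = flow a * flow b) ->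
  pflow a <-> is_ppower circ 0 p a.
Proof.
move=> circM.
have pow g k : flow (iter k (circ g) 0) = flow g ^+ k.
  by elim: k => [|k IH]; rewrite ?flow0 // exprS /= circM IH.
split=> [[w Ew]|[g ->]].
  by exists (flows_W mul w); apply: flow_inj; rewrite pow flowW Ew rexp_ellX.
by exists (flows_Omega mul g); rewrite pow rexp_ellX.
Qed.

Lemma flow_inv circ w wi : (forall a b, flow (circ a b) = flow a * flow b) ->
  circ wi w = 0 -> flow wi = exp (- ell (flows_Omega mul w)).
Proof.
move=> circM ww; rewrite -[LHS]mulr1 -(rexpKN cP FP (ell_fil (flows_Omega mul w))).
by rewrite -/(flow w) mulrA -circM ww flow0 mul1r.
Qed.

(** With [A, A] inside pA, commutators fall into exp(pA). This is a subgroup made of p-th powers, so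
    every element of the derived group is itself a generator of the target. *)
Lemma flows_circ_powerful :
  powerful_preLie p mul -> powerful_group p (flows_circ mul).
Proof.
move=> mul_powerful e e1 x.
have -> : e = 0.
  have <- : flows_circ mul e 0 = e by apply: flow_inj; rewrite flowM flow0 mulr1.
  exact: e1.
have gP := ell_image_grp pmult_grp; have gA := ell_image_grp allT_grp.
have PA f : ell_image pmult f -> ell_image allT f by case=> u _ ->; exists u.
have rP := @ell_image_rbr allT allT pmult (fun u v _ _ => mul_powerful u v).
move=> Hx K _ _ _; apply; apply/(pflowP _ flowM); apply: pflow_gen flowM _ Hx.
move=> a [u [v [ui [vi [uu vv ->]]]]].
pose U := flows_Omega mul u; pose V := flows_Omega mul v.
have [_ [_ [w ->] ->] Ez] := commutator_rexp (ltn0Sn n) cP FP gA gP PA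
  (@ell_image_fil allT) rP (ex_intro2 _ _ U I erefl) (ex_intro2 _ _ V I erefl).
by exists w; rewrite Ez !flowM (flow_inv flowM uu) (flow_inv flowM vv).
Qed.

(** All group commutators lie in exp(pA), and [rbr_of_commutators] transfers this to brackets, pA
    being an ideal by bi-additivity. *)
Lemma preLie_powerful circ : (forall a b, flow (circ a b) = flow a * flow b) ->
  (forall a, circ 0 a = a) -> powerful_group p circ -> powerful_preLie p mul.
Proof.
move=> circM circ0 pow x y.
have gP := ell_image_grp pmult_grp; have gA := ell_image_grp allT_grp.
have PA f : ell_image pmult f -> ell_image allT f by case=> u _ ->; exists u.
have rA := @ell_image_rbr allT allT allT (fun u v _ _ => I).
have rP : forall f g, ell_image allT f -> ell_image pmult g -> ell_image pmult (rbr f g).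
  apply: ell_image_rbr => u _ _ [v ->]; exists (mul u v - mul v u).
  by rewrite mulMnr mulMnl mulrnBl.
have [|z pz] := rbr_of_commutators (ltn0Sn n) cP FP gA gP PA
  (@ell_image_fil allT) rA rP _ (ex_intro2 _ _ x I erefl) (ex_intro2 _ _ y I erefl).
  move=> _ _ [u _ ->] [v _ ->]; pose a := flows_W mul u; pose b := flows_W mul v.
  have inv d : exists di, circ di d = 0.
    have [di di_d _] := flowV d; exists di.
    by apply: flow_inj; rewrite circM di_d flow0.
  have [ai aai] := inv a; have [bi bbi] := inv b.
  have [w Ew] : pflow (circ (circ ai bi) (circ a b)).
    apply: (pflow_gen circM (fun g => proj2 (pflowP g circM))).
    by apply: pow => // H _ _ _; apply; exists a, b, ai, bi.
  exists (ell (w *+ p)); first by exists (w *+ p) => //; exists w.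
  by rewrite -Ew !circM (flow_inv circM aai) (flow_inv circM bbi) !flowW !flows_WK.
rewrite ell_rbr => /ell_inj ->; exact: pz.
Qed.

End Flows.

Lemma flows_circ_inj (p n : nat) (T : finZmodType) (mul1 mul2 : T -> T -> T) :
  prime p -> (n.+1 < p)%N -> #|T| = (p ^ n)%N ->
  preLie mul1 -> left_nilpotent mul1 -> preLie mul2 -> left_nilpotent mul2 ->
  (forall a b, flows_circ mul1 a b = flows_circ mul2 a b) ->
  forall a b, mul1 a b = mul2 a b.
Proof.
move=> p_pr np cardT [mD1 mL1 mP1] nil1 [mD2 mL2 mP2] nil2 E a b.
(* The element whose exponential under [mul2] should be that of [a] under [mul1]; injectivity of exp
   then identifies the affine maps, hence both their translation parts and their linear parts. *)
pose a2 := flows_Omega mul2 (flows_W mul1 a).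
have Eflow := flowW p_pr np cardT mD1 mL1 nil1 mP1 a.
have Eell : ell p_pr cardT mD1 a = ell p_pr cardT mD2 a2.
  apply: (rexp_inj (fact_inv_endo p_pr np cardT) (ltn0Sn n)); try exact: ell_nilpotent.
  rewrite -Eflow -/(flow p_pr cardT mD2 _); apply: endo_ext => [x|].
    by rewrite !flow_vec //; congr (vec (_ - _)); apply: E.
  by rewrite !flow_unit.
have aa2 : a = a2.
  have := congr1 (fun f : endo T _ => f unit_point) Eell.
  by rewrite /= !ell_unit => /vec_inj.
have := congr1 (fun f : endo T _ => f (vec b)) Eell.
by rewrite /= !ell_vec -aa2 => /vec_inj.
Qed.

(** * Strong nilpotency of powerful pre-Lie rings *)

Section StrongNilpotency.
Variables (p n : nat) (T : finZmodType) (mul : T -> T -> T).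
Hypothesis cardT : #|T| = (p ^ n)%N.
Hypotheses (mul_preLie : preLie mul) (mul_powerful : powerful_preLie p mul).
Variable m : nat.
Hypothesis mul_nil : forall (s : seq T) (a : T), size s = m -> foldr mul a s = 0.

Let mulDr a x y : mul a (x + y) = mul a x + mul a y.
Proof. by case: mul_preLie => H _ _; exact: H. Qed.
Let mulDl b x y : mul (x + y) b = mul x b + mul y b.
Proof. by case: mul_preLie => _ H _; exact: H. Qed.

Let grp := pmult_grp p T.
Implicit Types x y z a b u v w : T.

Let eqp_refl x : pmult p (x - x).
Proof. by rewrite subrr; apply: subgrp0. Qed.
Let eqp_trans y x z : pmult p (x - y) -> pmult p (y - z) -> pmult p (x - z).
Proof. by move=> xy yz; rewrite -[x](subrK y) -addrA; apply: subgrpD. Qed.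

Let pmult_mulr a x : pmult p x -> pmult p (mul a x).
Proof. by case=> y ->; exists (mul a y); rewrite mulMnr. Qed.
Let pmult_mull a x : pmult p x -> pmult p (mul x a).
Proof. by case=> y ->; exists (mul y a); rewrite mulMnl. Qed.

Let eqp_mul a b x y : pmult p (a - b) -> pmult p (x - y) -> pmult p (mul a x - mul b y).
Proof.
move=> ab xy; apply: (@eqp_trans (mul a y)).
  by rewrite -mul_sub //; apply: pmult_mulr.
by rewrite -mul_subl //; apply: pmult_mull.
Qed.

Let eqp_comm x y : pmult p (mul x y - mul y x).
Proof. exact: mul_powerful. Qed.

(** Modulo [p] the product commutes, so by the pre-Lie identity left multiplications commute as
    well: (xy)z = z(xy) = x(zy) = x(yz). *)
Let eqp_assoc x y z : pmult p (mul (mul x y) z - mul x (mul y z)).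
Proof.
have swap u v w : pmult p (mul u (mul v w) - mul v (mul u w)).
  have [_ _ /(_ u v w) E] := mul_preLie.
  have -> : mul u (mul v w) - mul v (mul u w) = mul (mul u v - mul v u) w.
    rewrite mul_subl // -[mul (mul u v) w](subrK (mul u (mul v w))) E.
    by rewrite addrAC (addrAC (mul (mul v u) w)) subrr add0r addrC.
  exact: pmult_mull.
apply: eqp_trans (eqp_comm _ _) _; apply: eqp_trans (swap _ _ _) _.
by apply: eqp_mul.
Qed.

(** Associativity modulo [p] turns any bracketing into a right-nested product of the same length,
    which left nilpotency annihilates. *)
Lemma prodn_pmult k x : prodn mul k x -> (m < k)%N -> pmult p x.
Proof.
move=> Pkx mk; suff [s [a [sk ax]]] : exists s a, size s = k.-1 /\ pmult p (x - foldr mul a s).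
  rewrite -[x]subr0; apply: eqp_trans ax _; rewrite subr0.
  rewrite -(cat_take_drop m s) foldr_cat mul_nil; first exact: subgrp0.
  by rewrite size_takel // sk -ltnS prednK //; lia.
have pos i z : prodn mul i z -> (0 < i)%N by elim=> // *; lia.
elim: Pkx {mk} => {k x} [a|i j x y Px [s [a [si xs]]] Py [t [b [sj yt]]]].
  by exists [::], a.
exists (s ++ a :: t), b; split.
  by rewrite size_cat /= si sj; have := pos _ _ Px; have := pos _ _ Py; lia.
rewrite foldr_cat /=; apply: eqp_trans (eqp_mul xs yt) _.
move: (foldr mul b t) => w; elim: s {si xs} => //= h s IH.
by apply: eqp_trans (eqp_assoc _ _ _) _; apply: eqp_mul.
Qed.

(** The factor [p] comes from a subproduct with more than [m] factors whose two halves have at most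
    [m] each; a single factor replaces it, at a loss of fewer than [m.+1.*2]. *)
Lemma prodn_extract k x : prodn mul k x -> (m < k)%N ->
  exists l y, [/\ x = y *+ p, prodn mul l y & (k <= l + m.+1.*2)%N].
Proof.
elim=> {k x} [a m0|i j x y Px IHx Py IHy mij].
  by have [y ->] := prodn_pmult (prodn1 mul a) m0; exists 1%N, y; split=> //; exact: prodn1.
have [mi|im] := ltnP m i.
  have [l [z [-> Pz il]]] := IHx mi; exists (l + j)%N, (mul z y); split; last by lia.
    by rewrite mulMnl.
  exact: prodnM.
have [mj|jm] := ltnP m j.
  have [l [z [-> Pz jl]]] := IHy mj; exists (i + l)%N, (mul x z); split; last by lia.
    by rewrite mulMnr.
  exact: prodnM.
have [z ->] := prodn_pmult (prodnM Px Py) mij.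
by exists 1%N, z; split; [|exact: prodn1|lia].
Qed.

Lemma prodn_expn j k x : prodn mul k x -> (j * m.+1.*2 + m < k)%N ->
  exists y, x = y *+ (p ^ j).
Proof.
elim: j k x => [|j IH] k x Px jk; first by exists x.
have [|l [y [-> Py kl]]] := prodn_extract Px; first by lia.
have [|z ->] := IH _ _ Py; first by lia.
by exists z; rewrite expnSr mulrnA.
Qed.

Lemma powerful_strongly_nilpotent : strongly_nilpotent mul.
Proof.
(* Long enough for [n] extractions, and [p ^ n] annihilates [T]. *)
exists (n * m.+1.*2 + m).+1 => k x lek Px.
by have [y ->] := prodn_expn Px lek; rewrite -cardT mulrn_card.
Qed.

End StrongNilpotency.

(** * From braces to pre-Lie rings *)

Section Brace.
Local Open Scope group_scope.
Local Open Scope ring_scope.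
Variables (p n : nat) (T : finZmodType) (circ : T -> T -> T).
Hypotheses (p_pr : prime p) (np : (n.+1 < p)%N) (cardT : #|T| = (p ^ n)%N).
Hypothesis braceP : is_brace circ.

Let circA a b d : circ a (circ b d) = circ (circ a b) d.
Proof. by case: braceP => -[H _] _; exact: H. Qed.
Let circD a b d : circ a (b + d) + a = circ a b + circ a d.
Proof. by case: braceP => _ H; exact: H. Qed.

Lemma brace_circx0 a : circ a 0 = a.
Proof. by have := circD a 0 0; rewrite addr0 => /addrI. Qed.

Lemma brace_circ0x a : circ 0 a = a.
Proof.
have [[_ [e [eP _]]] _] := braceP; have [ea _] := eP a.
by rewrite -{1}(_ : e = 0) //; have [<- _] := eP 0; rewrite brace_circx0.
Qed.

Lemma brace_inv a : exists2 b, circ a b = 0 & circ b a = 0.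
Proof.
have [[_ [e [eP inv]]] _] := braceP.
have e0 : e = 0 by have [<- _] := eP 0; rewrite brace_circx0.
by have [b []] := inv a; rewrite e0; exists b.
Qed.

Lemma brace_circI a : injective (circ a).
Proof.
have [b _ ba] := brace_inv a => x y /(congr1 (circ b)).
by rewrite !circA ba !brace_circ0x.
Qed.

Definition lam a b := circ a b - a.

Lemma lamD a x y : lam a (x + y) = lam a x + lam a y.
Proof.
rewrite /lam; apply/eqP; rewrite subr_eq; apply/eqP.
by apply: (addIr a); rewrite circD [in RHS]addrA subrK addrAC subrK.
Qed.
Lemma lam0 a : lam a 0 = 0.
Proof. by rewrite /lam brace_circx0 subrr. Qed.
Lemma lamB a x y : lam a (x - y) = lam a x - lam a y.
Proof. by apply/eqP; rewrite eq_sym subr_eq -lamD subrK. Qed.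
Lemma lam_circ a b x : lam (circ a b) x = lam a (lam b x).
Proof.
rewrite [lam b x]/lam lamB /lam -circA.
by rewrite opprB addrA subrK.
Qed.
Lemma lam0x x : lam 0 x = x.
Proof. by rewrite /lam brace_circ0x subr0. Qed.

Definition lamd a b := lam a b - b.
Lemma lamdB a x y : lamd a (x - y) = lamd a x - lamd a y.
Proof. by rewrite /lamd lamB (opprB x) (opprB (lam a y)) [y - x]addrC addrACA [- _ + y]addrC. Qed.

Definition left_perm a : {perm T} := perm (@brace_circI a).
Definition left_perms := [set left_perm a | a : T].

Lemma mem_left_perms a : left_perm a \in left_perms.
Proof. by apply/imsetP; exists a. Qed.

Lemma left_perms_group_set : group_set left_perms.
Proof.
apply/group_setP; split.
  apply/imsetP; exists 0 => //; apply/permP => x.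
  by rewrite perm1 permE brace_circ0x.
move=> _ _ /imsetP[a _ ->] /imsetP[b _ ->]; apply/imsetP; exists (circ b a) => //.
by apply/permP => x; rewrite permM !permE circA.
Qed.
Canonical left_perms_group := Group left_perms_group_set.

Lemma left_perms_pgroup : p.-group left_perms.
Proof.
rewrite /pgroup card_imset ?cardT; last first.
  move=> a b /permP/(_ 0); rewrite !permE !brace_circx0.
  exact.
by rewrite pnatX pnat_id.
Qed.

(** Recovers lambda_a from the permutation b -> a o b without choosing [a], whose value is that at
    0. *)
Definition lam_act_fun (x : T) (g : {perm T}) := g x - g 0.

Lemma lam_actE x a : lam_act_fun x (left_perm a) = lam a x.
Proof. by rewrite /lam_act_fun !permE brace_circx0. Qed.

Lemma lam_is_action : is_action left_perms lam_act_fun.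
Proof.
split=> [g x y /addIr/perm_inj //|x _ _ /imsetP[a _ ->] /imsetP[b _ ->]].
rewrite /act_morph !lam_actE -lam_circ -lam_actE.
congr (lam_act_fun x _); apply/permP => z; by rewrite permM !permE circA.
Qed.
Definition lam_act := Action lam_is_action.

(* A finite [p]-group acting on the nontrivial [p]-group [T / asc lamd i] fixes
   a nonzero coset. *)
Lemma asc_lamd_strict i : asc lamd i != setT -> asc lamd i.+1 != asc lamd i.
Proof.
move=> nT; apply/eqP => stab.
pose Z := asc_group lamdB i; pose S := rcosets Z [set: T].
have lamZ a z : z \in Z -> lam a z \in Z.
  move=> Zz; rewrite -[lam a z](subrK z); apply: (subgrpD (asc_grp lamdB i)) => //.
  by apply/ascP: a; rewrite stab.
have actZ a x : (lam_act^* (Z :* x) (left_perm a))%act = Z :* lam a x.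
  apply/eqP; rewrite eqEcard; apply/andP; split; last first.
    by rewrite card_setact !card_rcoset.
  apply/subsetP => _ /imsetP[y Zy ->]; rewrite /= lam_actE.
  move: Zy; rewrite !mem_rcoset => Zy.
  by have := lamZ a _ Zy; rewrite lamB.
have actsS : [acts left_perms, on S | lam_act^*].
  apply/subsetP => _ /imsetP[a _ ->]; rewrite !inE mem_left_perms /=.
  apply/subsetP => _ /rcosetsP[x _ ->]; rewrite inE actZ.
  by apply/rcosetsP; exists (lam a x); rewrite ?inE.
(* If the chain stalls, a coset fixed by every lambda_a is trivial: its representative lies in the
   next term, which equals the present one. *)
have fixS : 'Fix_(S | lam_act^*)(left_perms) = [set (Z : {set T})].
  apply/setP => X; rewrite in_setI in_set1; apply/andP/eqP => [[/rcosetsP[x _ ->] /afixP fX]|->].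
    apply: rcoset_id; rewrite [_ \in _](_ : _ = (x \in asc lamd i)) // -stab.
    apply/ascP => a; have := fX _ (mem_left_perms a).
    rewrite actZ => Ea; have := rcoset_refl Z (lam a x).
    by rewrite Ea mem_rcoset.
  split; first by apply/rcosetsP; exists 1%g; rewrite ?inE ?rcoset1.
  apply/afixP => _ /imsetP[a _ ->].
  by have := actZ a 1%g; rewrite [lam a _]lam0 rcoset1.
have := pgroup_fix_mod left_perms_pgroup actsS.
rewrite fixS cards1 => S1.
have : (#|[set: T] : Z|%g %| p ^ n)%N by rewrite -cardT -cardsT dvdn_indexg.
case/(dvdn_pfactor _ _ p_pr) => -[|e] _ Ee.
  have := Lagrange (subsetT Z); rewrite Ee muln1 => cZ.
  by case/negP: nT; rewrite eqEcard subsetT /= -cZ.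
have := prime_gt1 p_pr; move: S1; rewrite -/(#|[set: T] : Z|%g) Ee expnS modnMr.
by case: (p) => [|[|k]] //; rewrite modn_small.
Qed.

Local Notation q := (p ^ n.+1)%N.
Local Notation R := (endo T q).
Local Notation c := (fact_inv p n).
Local Notation exp := (rexp n.+1 c : R -> R).

Let q_gt1 := modulus_gt1 n p_pr.
Let Tq := mulrn_modulus cardT.
Let cP := fact_inv_endo p_pr np cardT.

Let asc_lamd_top := asc_top p_pr cardT lamdB asc_lamd_strict.

Definition brace_fil := flag_fil n (q := q) (asc lamd).

Lemma brace_filtration : filtration n.+1 brace_fil.
Proof.
apply: flag_filtration => //; [exact: asc_grp lamdB | exact: asc_subS lamdB].
Qed.
Let FP := brace_filtration.

Definition aff a : R := affine q_gt1 Tq a 1%N (lamB a).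

Lemma affE a b t : aff a (b, t) = (lam a b + a *+ t, t).
Proof. by rewrite (affineE q_gt1 Tq a 1 (lamB a)). Qed.
Lemma aff_vec a b : aff a (vec b) = vec (lam a b).
Proof. by rewrite affE mulrn_Zq0 addr0. Qed.
Lemma aff_unit a : aff a unit_point = vec a + unit_point.
Proof.
rewrite affE mulrn_Zq1 lam0 add0r.
by transitivity (a + 0 : T, 0 + 1 : 'Z_q); first rewrite addr0 add0r.
Qed.

Lemma aff_inj : injective aff.
Proof.
move=> a b /(congr1 (fun f : R => f unit_point)).
by rewrite !aff_unit => /addIr/vec_inj.
Qed.

Lemma affM a b : aff (circ a b) = aff a * aff b.
Proof.
apply: endo_ext => [x|]; rewrite endoME; first by rewrite !aff_vec lam_circ.
by rewrite !aff_unit endoD aff_vec aff_unit addrA -vecD /lam subrK.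
Qed.

Lemma aff0 : aff 0 = 1.
Proof.
apply: endo_ext => [x|]; rewrite endo1E; first by rewrite aff_vec lam0x.
by rewrite aff_unit vec0 add0r.
Qed.

Lemma aff_fil a : brace_fil 1 (aff a - 1).
Proof.
apply: flag_fil_affine1; first exact: asc_lamd_top.
by move=> i b /ascP/(_ a).
Qed.

Definition in_aff (f : R) := exists a, f = aff a.

Lemma in_aff1 : in_aff 1. Proof. by exists 0; rewrite aff0. Qed.
Lemma in_affM f g : in_aff f -> in_aff g -> in_aff (f * g).
Proof. by case=> a -> [b ->]; exists (circ a b); rewrite affM. Qed.
Lemma in_affV f : in_aff f -> exists2 g, in_aff g & g * f = 1.
Proof.
case=> a ->; have [b _ ba] := brace_inv a.
by exists (aff b); [exists b | rewrite -affM ba aff0].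
Qed.

Definition brace_lie := lcs n.+1 c brace_fil in_aff 0%N.

Lemma brace_lie_exp f : brace_lie f -> in_aff (exp f).
Proof. exact: (lcs_G (ltn0Sn n) cP FP in_aff1 in_affM in_affV). Qed.

Lemma brace_lie_grp : subgrp brace_lie.
Proof. exact: lcs_grp. Qed.

Lemma brace_lie_fil f : brace_lie f -> brace_fil 1 f.
Proof. exact: (lcs_F1 FP). Qed.

Lemma brace_lie_log a : exists2 f, brace_lie f & exp f = aff a.
Proof.
have [f Ff Ef] := rexp_surj cP FP (ltn0Sn n) (aff_fil a).
rewrite addrC subrK in Ef; exists f => //.
by apply: lcs_log; rewrite // Ef; exists a.
Qed.

Lemma brace_lie_vec f m : brace_lie f -> f m = vec (f m).1.
Proof.
move=> /brace_lie_fil Ff; have := flag_fil1_snd asc_lamd_top m Ff.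
by case: (f m) => b t /= ->.
Qed.

(** e^f is some [aff a] and fixes [unit_point], so a = 0 and e^f = 1. Hence translation parts
    determine elements of the Lie ring. *)
Lemma brace_lie_unit0 f : brace_lie f -> f unit_point = 0 -> f = 0.
Proof.
move=> Lf f0; have [a Ea] := brace_lie_exp Lf.
have := aff_unit a; rewrite -Ea rexp_endoE big_ord_recl /= fact_inv0 mulr1n.
rewrite big1 => [|i _]; last first.
  rewrite /bump /= add1n -iterS iterSr f0.
  have -> k : iter k f 0 = 0 by elim: k => //= k ->; rewrite endo0.
  by rewrite mul0rn.
rewrite addr0 -[X in X = _]add0r => /addIr; rewrite -vec0 => /vec_inj a0.
have Ff := brace_lie_fil Lf.
apply: (rexp_inj cP (ltn0Sn n)); first by apply: (fil_top FP); apply: (filX FP).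
  by rewrite exprS mul0r.
by rewrite Ea -a0 aff0 (rexp0 cP).
Qed.

(** Sending [a] to the translation part of the logarithm of [aff a] is an injective self-map of the
    finite set [T], hence onto. *)
Lemma brace_lie_point x : exists2 f, brace_lie f & f unit_point = vec x.
Proof.
have /fin_all_exists[u uP] a : exists f, brace_lie f /\ exp f = aff a.
  by have [f] := brace_lie_log a; exists f.
pose tau a := (u a unit_point).1.
have tau_inj : injective tau.
  move=> a b tab; have [[La Ea] [Lb Eb]] := (uP a, uP b).
  suff uab : u a = u b by apply: aff_inj; rewrite -Ea -Eb uab.
  apply/eqP; rewrite -subr_eq0; apply/eqP/brace_lie_unit0.
    exact: subgrpB brace_lie_grp La Lb.
  by rewrite endoBE (brace_lie_vec _ La) (brace_lie_vec _ Lb) -/(tau a) tab subrr.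
exists (u (invF tau_inj x)); first by case: (uP (invF tau_inj x)).
have [/brace_lie_vec -> _] := uP (invF tau_inj x).
by rewrite -/(tau _) f_invF.
Qed.

Lemma brace_lie_ext f g : brace_lie f -> brace_lie g ->
  f unit_point = g unit_point -> f = g.
Proof.
move=> Lf Lg fg; apply/eqP; rewrite -subr_eq0; apply/eqP/brace_lie_unit0.
  exact: subgrpB brace_lie_grp Lf Lg.
by rewrite endoBE fg subrr.
Qed.

(** [w x] is the unique element of the Lie ring with translation part [x], and x . b is its linear
    part at [b]. Uniqueness gives additivity in [x], closure under brackets the pre-Lie identity. *)
Lemma brace_preLie : exists mul : T -> T -> T,
  [/\ preLie mul, left_nilpotent mul & forall a b, flows_circ mul a b = circ a b].
Proof.
have /fin_all_exists[w wP] x : exists f, brace_lie f /\ f unit_point = vec x.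
  by have [f] := brace_lie_point x; exists f.
have wL x : brace_lie (w x) by case: (wP x).
have wu x : w x unit_point = vec x by case: (wP x).
have wE f x : brace_lie f -> f unit_point = vec x -> f = w x.
  by move=> Lf fx; apply: brace_lie_ext => //; rewrite wu.
pose mul x b := (w x (vec b)).1.
have wv x b : w x (vec b) = vec (mul x b) by apply: brace_lie_vec.
have mulDr a : {morph mul a : x y / x + y}.
  by move=> x y; apply: (@vec_inj T q); rewrite vecD -!wv vecD endoD.
have wD x y : w (x + y) = w x + w y.
  apply/esym/wE; first exact: subgrpD brace_lie_grp (wL x) (wL y).
  by rewrite endoDE !wu vecD.
have mulDl b : {morph mul^~ b : x y / x + y}.
  by move=> x y; apply: (@vec_inj T q); rewrite vecD -!wv wD endoDE.
have mulP : preLie mul.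
  split=> // x y z.
  have Er : rbr (w x) (w y) = w (mul x y - mul y x).
    apply: wE; first by apply/lcsW/(lcs_rbr (wL x) (wL y)).
    by rewrite endoBE !endoME !wu !wv vecB.
  have := congr1 (fun f : R => f (vec z)) Er.
  rewrite /= endoBE !endoME !wv -vecB => /vec_inj E.
  have : mul x (mul y z) - mul y (mul x z) = mul (mul x y) z - mul (mul y x) z.
    by rewrite E mul_subl.
  move/eqP; rewrite subr_eq => /eqP ->.
  by rewrite opprD opprB addrA (addrC (mul (mul x y) z)) subrK.
(* [w x] has filtration degree 1, so each left multiplication descends one step of [asc lamd]. *)
have nil : left_nilpotent mul.
  exists n => s a sn.
  have : a \in asc lamd (size s + 0)%N by rewrite addn0 asc_lamd_top ?inE ?sn.
  have : foldr mul a s \in asc lamd 0 -> foldr mul a s = 0 by rewrite inE => /eqP.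
  move=> + Za; apply; move: (0%N) Za => i; elim: s i {sn} => [//|x s IH] i.
    rewrite [size _]/= [foldr _ _ (_ :: _)]/= addSnnS => /IH {IH} Zf.
  have [] := brace_lie_fil (wL x) (i := i) (m := vec (foldr mul a s)).
    by rewrite addn1; split=> //; left.
  by rewrite wv.
have [_ _ mul3] := mulP.
exists mul; split=> // a b.
have Eell x : ell p_pr cardT mulDr x = w x.
  by apply: endo_ext => [y|]; rewrite ?ell_vec ?ell_unit ?wv ?wu.
(* Both maps belong to the group of the brace, where the translation part determines the element. *)
have Eflow : flow p_pr cardT mulDr a = aff a.
  have [a' Ea'] := brace_lie_exp (wL (flows_Omega mul a)).
  have Ef : flow p_pr cardT mulDr a = aff a' by rewrite /flow Eell Ea'.
  have := flow_unit p_pr np cardT mulDr mulDl nil mul3 a.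
  by rewrite Ef aff_unit => /addIr/vec_inj <-.
have := flow_vec p_pr np cardT mulDr nil a b.
by rewrite Eflow aff_vec => /vec_inj/addIr.
Qed.

End Brace.

Theorem theorem5p2 (p n : nat) (T : finZmodType) :
  prime p -> ((n.+1 ^ n.+1).+1 < p)%N -> #|T| = (p ^ n)%N ->
  [/\ (forall mul : T -> T -> T,
         preLie mul -> left_nilpotent mul -> powerful_preLie p mul ->
         is_brace (flows_circ mul) /\ powerful_group p (flows_circ mul)),
      (forall circ : T -> T -> T,
         is_brace circ -> powerful_group p circ ->
         exists mul : T -> T -> T,
           [/\ preLie mul, left_nilpotent mul, strongly_nilpotent mul,
               powerful_preLie p mul &
               forall a b, flows_circ mul a b = circ a b]) &
      (forall mul1 mul2 : T -> T -> T,
         preLie mul1 -> left_nilpotent mul1 -> powerful_preLie p mul1 ->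
         preLie mul2 -> left_nilpotent mul2 -> powerful_preLie p mul2 ->
         (forall a b, flows_circ mul1 a b = flows_circ mul2 a b) ->
         forall a b, mul1 a b = mul2 a b)].
Proof.
move=> p_pr large_p cardT.
have np : (n.+1 < p)%N.
  by apply: leq_ltn_trans (ltnW large_p); rewrite -{1}(expn1 n.+1) leq_pexp2l.
split=> [mul [mD mL mP] nil pow | circ braceP pow | mul1 mul2 mP1 nil1 _ mP2 nil2 _].
- split; first exact: (flows_circ_brace p_pr np cardT mD mL nil mP).
  exact: (flows_circ_powerful p_pr np cardT mD mL nil mP pow).
- have [mul [mulP nil E]] := brace_preLie p_pr np cardT braceP.
  have [mD mL mP] := mulP.
  have mul_pow : powerful_preLie p mul.
    have circM a b :
        flow p_pr cardT mD (circ a b) = flow p_pr cardT mD a * flow p_pr cardT mD b.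
      by rewrite -E; apply: (flowM p_pr np cardT mD mL nil mP).
    exact: (preLie_powerful np mL nil mP circM (brace_circ0x braceP) pow).
  exists mul; split=> //; have [m mnil] := nil.
  exact: (powerful_strongly_nilpotent cardT mulP mul_pow mnil).
- exact: (flows_circ_inj p_pr np cardT mP1 nil1 mP2 nil2).
Qed.
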